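(* Let $k$ be a positive integer, let $u_0\in H^3(\mathbb{R})$, and let $u$ be the corresponding solution, with lifespan $T>0$, of the Cauchy problem $$u_t-u_{txx}+u^ku_x-u^ku_{xxx}=0,\qquad u(0,x)=u_0(x).$$ Put $m=u-u_{xx}$ and $m_0=u_0-u_0''$. Then: 1. If $m_0$ does not change sign, then $m$ does not change sign either; moreover $\mathrm{sgn}(m)=\mathrm{sgn}(m_0)$ (that is, $m$ has the same constant sign as $m_0$). 2. For each $t\in[0,T)$, the momentum $m(t,\cdot)$ is compactly supported if and only if $m_0$ is compactly supported. 3. If $m_0\geq 0$ (respectively $m_0\leq 0$), then $u(t,x)\geq 0$ (respectively $u(t,x)\leq 0$) for all $(t,x)\in[0,T)\times\mathbb{R}$. 4. If $m_0\geq 0$ (respectively $m_0\leq 0$), then $(u+u_x)(t,x)\geq 0$ (respectively $(u+u_x)(t,x)\leq 0$) for all $(t,x)\in[0,T)\times\mathbb{R}$.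
   Context: $H^s(\mathbb{R})$ is the usual Sobolev space of order $s$. The Cauchy problem is locally well-posed in $H^s(\mathbb{R})$ for $s>3/2$: for $u_0\in H^s(\mathbb{R})$ there is a unique solution $u\in C^0([0,T);H^s(\mathbb{R}))\cap C^1([0,T);H^{s-1}(\mathbb{R}))$; $T>0$ denotes its lifespan and this $u$ is ''the corresponding solution''. Saying that a function does not change sign means that it is everywhere $\geq0$ or everywhere $\leq 0$. *)

(* Defs.v *)
From HB Require Import structures.
From mathcomp Require Import all_boot all_order all_algebra.
From mathcomp Require Import all_classical all_reals all_analysis.
Set Implicit Arguments.
Unset Strict Implicit.
Unset Printing Implicit Defensive.
Import Order.TTheory GRing.Theory Num.Theory.
Import numFieldNormedType.Exports.
Local Open Scope classical_set_scope.
Local Open Scope ring_scope.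

Definition compactly_supported (R : realType) (f : R -> R) : Prop :=
  compact (closure [set x | f x != 0]).

Definition test_function (R : realType) (phi : R -> R) : Prop :=
  (forall n x, derivable (derive1n n phi) x 1) /\ compactly_supported phi.

(* Only used for f and g in L^2, where both integrands are integrable, so that
   the default value of the Lebesgue integral plays no role. *)
Definition is_weak_derivative (R : realType) (j : nat) (f g : R -> R) : Prop :=
  forall phi : R -> R, test_function phi ->
    \int[lebesgue_measure]_x (f x * derive1n j phi x) =
    (-1) ^+ j * \int[lebesgue_measure]_x (g x * phi x).

(* H^n(R) for integer n: square-integrable functions whose weak derivatives of
   order <= n are square integrable. Elements are functions, not classes. *)
Definition sobolev (R : realType) (n : nat) (f : R -> R) : Prop :=
  f \in Lfun lebesgue_measure 2%:E /\
  forall j, (j <= n)%N ->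
    exists2 g : R -> R, g \in Lfun lebesgue_measure 2%:E
                      & is_weak_derivative j f g.

(* The L^2 weak derivative of order j, determined only up to a null set
   (arbitrary if there is none). *)
Definition weak_derivative (R : realType) (j : nat) (f : R -> R) : R -> R :=
  get [set g | g \in Lfun lebesgue_measure 2%:E /\ is_weak_derivative j f g].

Definition sobolev_norm (R : realType) (n : nat) (f : R -> R) : R :=
  Num.sqrt (\sum_(j < n.+1)
    \int[lebesgue_measure]_x (weak_derivative j f x ^+ 2)).

(* [0, T), where T may be infinite *)
Definition time_interval (R : realType) (T : \bar R) : set R :=
  [set t | 0 <= t /\ (t%:E < T)%E].

(* C^0([0, T); H^n) *)
Definition sobolev_C0 (R : realType) (n : nat) (T : \bar R)
    (u : R -> R -> R) : Prop :=
  (forall t, time_interval T t -> sobolev n (u t)) /\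
  (forall t, time_interval T t ->
    sobolev_norm n (u s \- u t) @[s --> within (time_interval T) (nbhs t)]
      --> (0 : R)).

(* v is the derivative of u : [0, T) -> H^n for the H^n norm
   (one-sided at t = 0). *)
Definition sobolev_time_derivative (R : realType) (n : nat) (T : \bar R)
    (u v : R -> R -> R) : Prop :=
  forall t, time_interval T t ->
    sobolev_norm n (fun x => (s - t)^-1 * (u s x - u t x) - v t x)
      @[s --> within (time_interval T) t^'] --> (0 : R).

(* u in C^0([0, T); H^3) /\ C^1([0, T); H^2), with time derivative v in H^2,
   satisfies u_t - u_txx + u^k u_x - u^k u_xxx = 0 as an identity in L^2(R) at
   each time. Elements of H^3(R) are represented by their continuous
   representative, so that pointwise statements about u make sense. *)
Definition solution_on (R : realType) (k : nat) (u0 : R -> R) (T : \bar R)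
    (u : R -> R -> R) : Prop :=
  [/\ sobolev_C0 3 T u,
      forall t, time_interval T t -> continuous (u t),
      u 0 = u0 &
      exists v : R -> R -> R,
        [/\ sobolev_C0 2 T v,
            sobolev_time_derivative 2 T u v &
            forall t, time_interval T t ->
              {ae lebesgue_measure, forall x : R,
                v t x - weak_derivative 2 (v t) x
                + u t x ^+ k * weak_derivative 1 (u t) x
                - u t x ^+ k * weak_derivative 3 (u t) x = 0}]].

Definition solution_with_lifespan (R : realType) (k : nat) (u0 : R -> R)
    (T : \bar R) (u : R -> R -> R) : Prop :=
  [/\ (0 < T)%E, solution_on k u0 T u &
      forall (T' : \bar R) (w : R -> R -> R),
        solution_on k u0 T' w -> (T' <= T)%E].

(* f - f''. For a continuous f in H^3(R) the classical derivatives up to order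
   2 exist everywhere and are continuous (Sobolev embedding), so this is the
   continuous representative of the momentum. *)
Definition momentum (R : realType) (f : R -> R) : R -> R :=
  fun x => f x - derive1n 2 f x.

Definition does_not_change_sign (R : realType) (X : Type) (A : set X)
    (f : X -> R) : Prop :=
  (forall x, A x -> 0 <= f x) \/ (forall x, A x -> f x <= 0).

(* Main.v *)
(* The momentum solves the transport equation [m_t + u^k m_x = 0], so its sign
   and its support are carried along by the velocity [u^k].  Since [m] is only
   H^1 in space and C^1 in time with values in L^2, this is proved by an energy
   estimate instead of characteristics.  If [d] is a C^1 subsolution,
   [d_t + c d_x <= 0] with [c = u^k], then [e = d - m] satisfies
   [d/dt int (e^+)^2 <= - int c ((e^+)^2)_x = int c_x (e^+)^2], and Gronwall's
   lemma shows that [m >= d] persists.  With [|c| <= M], the subsolutions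
   [kappa (((r + rho t)^2 - x^2)^+)^2] are enough: [kappa = 0] gives the weak
   sign, [kappa > 0] on a cone shrinking at speed [M] the strict sign, and
   [kappa < 0] on a cone growing at speed [M] the vanishing of [m] far away.
   The last step also runs backward in time.  Finally [m >= 0] gives
   [(exp (- x) (u + u_x))' = - exp (- x) m <= 0] with [u + u_x] bounded, hence
   [u + u_x >= 0], and then [(exp x u)' = exp x (u + u_x) >= 0] gives [u >= 0].

   The link with the weak formulation is the one-dimensional Sobolev embedding:
   the weak derivatives of the continuous representative are, up to null sets,
   classical ones (du Bois-Reymond). *)

(* Once the velocity c = u^k is frozen, the equation is linear in m, so every statement with the
   opposite sign is the same statement for -m. Compact support is split likewise, into nonnegativity
   of m and of -m for large |x|. One computation tunes the barriers: with P the positive part of (r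
   + rho t)^2 - x^2, one has d_t + c d_x = 4 kappa P (rho (r + rho t) - c x), and P > 0 only where
   |x| < r + rho t. Hence kappa rho <= - |kappa| M makes d a subsolution, and reversing time flips
   the sign of kappa rho. Squaring P makes d of class C^1; compact support puts it in L^2. The
   obstacle is regularity: m(t) is only an integral of an L^2 function, so the chain rule for
   (e^+)^2 is not classical. It is obtained by approximating the density in L^1 by continuous
   functions, which works because 2 y^+ is Lipschitz. The same property gives the quadratic Taylor
   remainder that differentiates the energy in time. Boundary terms vanish along the integers, and M
   on [0, tau] comes from compactness and the embedding of H^3 into C^1. *)
Require Import Defs.
From HB Require Import structures.
From mathcomp Require Import all_boot all_order all_algebra.
From mathcomp Require Import all_classical all_reals all_analysis.
From mathcomp Require Import measurable_realfun.
From mathcomp Require Import ring lra.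
Import Order.TTheory GRing.Theory Num.Theory.
Import numFieldNormedType.Exports.
Local Open Scope classical_set_scope.
Local Open Scope ring_scope.
Set Implicit Arguments.
Unset Strict Implicit.
Unset Printing Implicit Defensive.

(** * Integrals and primitives *)

Section Toolkit.
Context {R : realType}.
Implicit Types (f g h : R -> R) (a b c x y : R) (D E : set (measurableTypeR R)).
Local Notation mu := (@lebesgue_measure R).
Local Notation intg D f := (integrable mu D (EFin \o f)).

Lemma intg_le D f g : measurable D -> measurable_fun D f -> intg D g ->
  (forall x, D x -> `|f x| <= g x) -> intg D f.
Proof.
move=> mD mf ig fg; apply: (le_integrable mD _ _ ig).
  exact/measurable_EFinP.
by move=> x Dx /=; rewrite lee_fin (le_trans (fg x Dx)) ?ler_norm.
Qed.

Lemma intgD D f g : measurable D -> intg D f -> intg D g ->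
  intg D (fun x => f x + g x).
Proof.
move=> mD If Ig; have := integrableD mD If Ig.
by apply: eq_integrable => // x _ /=; rewrite EFinD.
Qed.

Lemma intgZ D c f : measurable D -> intg D f -> intg D (fun x => c * f x).
Proof.
move=> mD If; have := integrableZl mD c If.
by apply: eq_integrable => // x _ /=; rewrite EFinM.
Qed.

Lemma intgB D f g : measurable D -> intg D f -> intg D g ->
  intg D (fun x => f x - g x).
Proof.
move=> mD If Ig; have := integrableB mD If Ig.
by apply: eq_integrable => // x _ /=; rewrite EFinB.
Qed.

Lemma intg_norm D f : intg D f -> intg D (fun x => `|f x|).
Proof. exact: integrable_norm. Qed.

Lemma intg_meas D f : intg D f -> measurable_fun D f.
Proof. by move=> /integrableP[/measurable_EFinP]. Qed.

Lemma intg_sub D E f : measurable D -> measurable E -> E `<=` D ->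
  intg D f -> intg E f.
Proof. by move=> mD mE ED; apply: integrableS. Qed.

Lemma intg_cc_continuous a b f : continuous f -> intg `[a, b] f.
Proof.
move=> cf; apply: continuous_compact_integrable; first exact: segment_compact.
exact: continuous_subspaceT.
Qed.

Lemma Rintegral_dominated D (f_ : (R -> R)^nat) f g : measurable D ->
  (forall n, measurable_fun D (f_ n)) ->
  (forall x, D x -> f_ n x @[n --> \oo] --> f x) -> intg D g ->
  (forall n x, D x -> `|f_ n x| <= g x) ->
  intg D f /\ \int[mu]_(x in D) f_ n x @[n --> \oo] --> \int[mu]_(x in D) f x.
Proof.
move=> mD mf_ cf ig fg.
have mf : measurable_fun D f by exact: (measurable_fun_cvg mf_).
have fdom x : D x -> `|f x| <= g x.
  move=> Dx; have /cvg_norm /= h := cf x Dx.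
  by rewrite -(cvg_lim _ h)//; apply: limr_le; [apply/cvg_ex; by exists (`|f
    x|)|apply: nearW => n; exact: fg].
have If : intg D f by apply: (intg_le _ mf ig).
split=> //.
have := @dominated_cvg _ _ _ mu D mD (fun n => EFin \o f_ n) (EFin \o f) (EFin \o g).
move=> H; apply: fine_cvg; rewrite /Rintegral fineK; last exact: integrable_fin_num.
apply: H => //.
- by move=> n; exact/measurable_EFinP.
- by move=> x Dx; apply/fine_cvgP; split; [exact: nearW|exact: cf].
Qed.

Lemma le_Rintegral_norm D f g : measurable D -> measurable_fun D f ->
  intg D g -> (forall x, D x -> `|f x| <= g x) ->
  `|\int[mu]_(x in D) f x| <= \int[mu]_(x in D) g x.
Proof.
move=> mD mf ig fg; have If := intg_le mD mf ig fg.
apply: le_trans (le_normr_Rintegral _ If) _ => //.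
apply: le_Rintegral => //; exact: intg_norm.
Qed.

Lemma Rintegral_ge0_sub D E f : measurable D -> measurable E -> E `<=` D ->
  intg D f -> (forall x, D x -> 0 <= f x) ->
  \int[mu]_(x in E) f x <= \int[mu]_(x in D) f x.
Proof.
move=> mD mE ED If f0; rewrite fine_le//.
- by apply: integrable_fin_num => //; apply: intg_sub If.
- exact: integrable_fin_num.
- apply: ge0_subset_integral => //.
  by case/integrableP : If.
Qed.

Lemma Rintegral_cat a b c f : a <= b -> b <= c -> intg `[a, c] f ->
  \int[mu]_(x in `[a, c]) f x =
  \int[mu]_(x in `[a, b]) f x + \int[mu]_(x in `[b, c]) f x.
Proof.
move=> ab bc If; apply/eqP; rewrite addrC -subr_eq; apply/eqP.
rewrite (@Rintegral_itvB _ _ (BLeft a) (BRight c) b)//.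
apply: Rintegral_itv_obnd_cbnd; apply: intg_sub If => //.
by apply: subset_itvScc; rewrite // bnd_simp.
Qed.

Lemma ae_mono (P Q : R -> Prop) : (forall x, P x -> Q x) ->
  {ae mu, forall x, P x} -> {ae mu, forall x, Q x}.
Proof. by move=> PQ; exact: (@filterS _ _ (ae_filter_ringOfSetsType mu) _ _ PQ). Qed.

Lemma ae_eq_Rintegral D f g : measurable D -> measurable_fun D f ->
  measurable_fun D g -> {ae mu, forall x, D x -> f x = g x} ->
  \int[mu]_(x in D) f x = \int[mu]_(x in D) g x.
Proof.
move=> mD mf mg fg; congr fine; apply: ae_eq_integral => //.
- exact/measurable_EFinP.
- exact/measurable_EFinP.
- apply: ae_mono fg.
by move=> x h Dx /=; rewrite h.
Qed.

(** Absolute continuity of f with density g, in integral form: g is only locally integrable, so f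
    need not be differentiable everywhere. *)
Definition primitive f g := forall a b, a <= b ->
  intg `[a, b] g /\ f b - f a = \int[mu]_(x in `[a, b]) g x.

Lemma primitive_ex g : (forall a b, intg `[a, b] g) -> exists f, primitive f g.
Proof.
move=> Ig; exists (fun x => \int[mu]_(t in `[0, x]) g t - \int[mu]_(t in `[x, 0]) g
  t).
move=> a b ab; split=> //.
have H x : x < 0 -> \int[mu]_(t in `[0, x]) g t = 0.
  by move=> x0; rewrite set_itv_ge ?Rintegral_set0// bnd_simp -ltNge.
have H' x : 0 < x -> \int[mu]_(t in `[x, 0]) g t = 0.
  by move=> x0; rewrite set_itv_ge ?Rintegral_set0// bnd_simp -ltNge.
have H0 : \int[mu]_(t in `[0, 0]) g t = 0 by rewrite set_itv1 Rintegral_set1.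
have Ha x : 0 <= x -> \int[mu]_(t in `[x, 0]) g t = 0.
  by rewrite le_eqVlt => /predU1P[<-//|]; exact: H'.
have Hb x : x <= 0 -> \int[mu]_(t in `[0, x]) g t = 0.
  by rewrite le_eqVlt => /predU1P[->//|]; exact: H.
have [a0|a0] := leP 0 a.
  have := @Rintegral_cat 0 a b g a0 ab (Ig _ _).
  by rewrite !Ha ?(le_trans a0)//; lra.
have [b0|b0] := leP 0 b.
  have := @Rintegral_cat a 0 b g (ltW a0) b0 (Ig _ _).
  by rewrite (Ha b)// (Hb a) ?ltW//; lra.
have := @Rintegral_cat a b 0 g ab (ltW b0) (Ig _ _).
by rewrite !Hb 1?ltW//; lra.
Qed.

Lemma nbhs_itvoo a b x : a < x -> x < b -> nbhs x `]a, b[%classic.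
Proof.
move=> ax xb; apply: open_nbhs_nbhs; split; first exact: interval_open.
by rewrite /= in_itv /= ax xb.
Qed.

Lemma primitive_continuous f g : primitive f g -> continuous f.
Proof.
move=> pf x.
have /pf[Ig _] : x - 1 <= x + 1 by lra.
have xx : x - 1 <= x + 1 by lra.
have := parameterized_integral_continuous xx Ig.
move=> /subspace_continuousP /(_ x).
have xin : `[x - 1, x + 1]%classic x by rewrite /= in_itv /=; apply/andP; split; lra.
move=> /(_ xin); rewrite /parameterized_integral => H.
have nx : nbhs x `[x - 1, x + 1]%classic.
  apply: (@filterS _ _ _ `]x - 1, x + 1[%classic); first exact: subset_itv_oo_cc.
  by apply: nbhs_itvoo; lra.
have {}H : (fun y => f (x - 1) + \int[mu]_(t in `[(x - 1)%R, y]) g t) y @[y --> x] -->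
   f (x - 1) + \int[mu]_(t in `[x - 1, x]) g t.
  apply: cvgD; first exact: cvg_cst.
  by move: H; rewrite within_interior // /interior.
have E y : x - 1 <= y -> f (x - 1) + \int[mu]_(t in `[x - 1, y]) g t = f y.
  by move=> /pf[_ <-]; ring.
rewrite E in H; last by lra.
apply: cvg_trans H; apply: near_eq_cvg.
apply: filterS nx => y; rewrite /= in_itv /= => /andP[y1 y2].
by rewrite E.
Qed.

Lemma primitive_derive f g x : primitive f g -> {for x, continuous g} ->
  is_derive x (1 : R) f (g x).
Proof.
move=> pf cg.
have /pf[Ig _] : x - 1 <= x + 1 by lra.
have x1 : x < x + 1 by lra.
have x2 : x - 1 < x by lra.
have [dF eF] := continuous_FTC1_closed x1 Ig x2 cg.
have dG : is_derive x (1 : R) (fun y => f (x - 1) + \int[mu]_(t in `[(x - 1)%R, y])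
  g t) (g x).
  rewrite -[g x]add0r; apply: is_deriveD.
  apply: DeriveDef; first exact: dF.
  by rewrite -derive1E.
have E : {near x, (fun y => f (x - 1) + \int[mu]_(t in `[(x - 1)%R, y]) g t) =1 f}.
  have : nbhs x `]x - 1, x + 1[%classic by apply: nbhs_itvoo; lra.
  apply: filterS => y; rewrite /= in_itv /= => /andP[y1 y2].
  by have [_ <-] := pf (x - 1) y (ltW y1); ring.
by apply: near_eq_is_derive dG.
Qed.

Lemma C1_primitive f g : (forall x, is_derive x (1 : R) f (g x)) ->
  continuous g -> primitive f g.
Proof.
move=> df cg a b; split; first exact: intg_cc_continuous.
move: H; rewrite le_eqVlt => /predU1P[->|ab].
  by rewrite subrr set_itv1 Rintegral_set1.
have cf : continuous f.
  by move=> x; apply: differentiable_continuous; apply/derivable1_diffP.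
rewrite /Rintegral (continuous_FTC2 ab (F := f))//.
- exact: continuous_subspaceT.
- split.
  + by move=> x _.
  + by apply: cvg_at_right_filter; exact: cf.
  + by apply: cvg_at_left_filter; exact: cf.
- by move=> x _; rewrite derive1E derive_val.
Qed.

Lemma primitiveB f g f' g' : primitive f g -> primitive f' g' ->
  primitive (fun x => f x - f' x) (fun x => g x - g' x).
Proof.
move=> pf pf' a b ab; have [I1 E1] := pf a b ab; have [I2 E2] := pf' a b ab.
split; first exact: intgB.
by rewrite RintegralB// -E1 -E2; ring.
Qed.

End Toolkit.

(** * Chain rule for primitives of integrable functions *)

Section Chain.
Context {R : realType}.
Implicit Types (f g h : R -> R) (a b c x y : R).
Local Notation mu := (@lebesgue_measure R).
Local Notation intg D f := (integrable mu D (EFin \o f)).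

Lemma is_derive_continuous f g : (forall x, is_derive x (1 : R) f (g x)) ->
  continuous f.
Proof.
by move=> df x; apply: differentiable_continuous; apply/derivable1_diffP.
Qed.

Lemma is_derive_mul f g x (a b : R) : is_derive x (1 : R) f a -> is_derive x (1 :
  R) g b ->
  is_derive x (1 : R) (fun y => f y * g y) (a * g x + f x * b).
Proof.
move=> df dg; have := is_deriveM df dg.
by rewrite /GRing.scale /= addrC [g x * a]mulrC.
Qed.

Lemma is_derive_add f g x (a b : R) : is_derive x (1 : R) f a -> is_derive x (1 :
  R) g b ->
  is_derive x (1 : R) (fun y => f y + g y) (a + b).
Proof. by move=> df dg; exact: is_deriveD. Qed.

Lemma is_derive_sub f g x (a b : R) : is_derive x (1 : R) f a -> is_derive x (1 :
  R) g b ->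
  is_derive x (1 : R) (fun y => f y - g y) (a - b).
Proof. by move=> df dg; exact: is_deriveB. Qed.

Lemma is_derive_const x (a : R) : is_derive x (1 : R) (fun=> a) (0 : R).
Proof. exact: is_derive_cst. Qed.

Lemma is_derive_var x : is_derive x (1 : R) (fun y : R => y) (1 : R).
Proof. exact: is_derive_id. Qed.

Lemma is_derive_scale c f x (a : R) : is_derive x (1 : R) f a ->
  is_derive x (1 : R) (fun y => c * f y) (c * a).
Proof. by move=> df; exact: is_deriveZ. Qed.

Lemma is_derive_opp f x (a : R) : is_derive x (1 : R) f a ->
  is_derive x (1 : R) (fun y => - f y) (- a).
Proof. by move=> df; exact: is_deriveN. Qed.

Lemma is_derive_comp_fun f g x (a b : R) : is_derive (g x) (1 : R) f a ->
  is_derive x (1 : R) g b -> is_derive x (1 : R) (fun y => f (g y)) (a * b).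
Proof. exact: is_derive1_comp. Qed.

Lemma is_derive_congr f x (a b : R) : is_derive x (1 : R) f a -> a = b -> is_derive
  x (1 : R) f b.
Proof. by move=> + <-. Qed.

Lemma is_derive_near f g x (a : R) : is_derive x (1 : R) f a ->
  (\forall y \near x, f y = g y) -> is_derive x (1 : R) g a.
Proof. by move=> df fg; apply: near_eq_is_derive df. Qed.

(** The mean value theorem writes the remainder as (G' t - G' z) (y - z) with t between y and z. *)
Lemma lipschitz_taylor (G G' : R -> R) (K : R) : (forall y, is_derive y (1 : R) G
  (G' y)) ->
  (forall y z, `|G' y - G' z| <= K * `|y - z|) ->
  forall y z : R, `|G y - G z - G' z * (y - z)| <= K * (y - z) ^+ 2.
Proof.
move=> dG lipG y z.
have cG := is_derive_continuous dG.
have H (p q : R) : p < q -> exists2 t, p < t < q & G q - G p = G' t * (q - p).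
  move=> pq; have [//|t tpq E] := @MVT R G G' p q pq (fun x _ => dG x).
  - exact: continuous_subspaceT.
  - by exists t => //; rewrite in_itv /= in tpq.
have K0 t : `|t - z| <= `|y - z| ->
    `|(G' t - G' z) * (y - z)| <= K * (y - z) ^+ 2.
  move=> tz; rewrite normrM -real_normK ?num_real// expr2 mulrA.
  apply: ler_wpM2r => //; apply: le_trans (lipG t z) _.
  (* A negative K is excluded by the Lipschitz bound between 0 and 1. *)
  have [K0|K0] := leP 0 K; first exact: ler_wpM2l.
  have := lipG 0 1; rewrite sub0r normrN1 mulr1 => h.
  by have := le_lt_trans (le_trans (normr_ge0 _) h) K0; rewrite ltxx.
have [yz|zy|->] := ltgtP y z.
- have [t /andP[yt tz] E] := H _ _ yz.
  have -> : G y - G z - G' z * (y - z) = (G' t - G' z) * (y - z).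
    by rewrite -[G y - G z]opprB E; ring.
  by apply: K0; rewrite !ltr0_norm ?subr_lt0//; lra.
- have [t /andP[yt tz] E] := H _ _ zy.
  have -> : G y - G z - G' z * (y - z) = (G' t - G' z) * (y - z).
    by rewrite E; ring.
  by apply: K0; rewrite !gtr0_norm ?subr_gt0//; lra.
- by rewrite !subrr mulr0 subrr normr0 expr0n /= mulr0.
Qed.

Lemma lebesgue_cc a b : a <= b -> mu `[a, b]%classic = (b - a)%:E.
Proof.
move=> ab; rewrite lebesgue_measure_itv /= lte_fin.
by case: ltgtP ab => [//| |->]//= _; rewrite subrr.
Qed.

Lemma Rintegral_cst_cc a b c : a <= b -> \int[mu]_(x in `[a, b]) c = c * (b - a).
Proof.
move=> ab; rewrite /Rintegral integral_cst; last exact: measurable_itv.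
have := lebesgue_cc ab; set m := (X in X = _); set m' := (X in (_ * X)%E).
by move=> e; rewrite (_ : m' = (b - a)%:E).
Qed.

Lemma approx_L1 a b g (d : R) : 0 < d -> intg `[a, b] g ->
  exists h, continuous h /\ \int[mu]_(x in `[a, b]) `|g x - h x| <= d.
Proof.
move=> d0 Ig.
have fin : (mu `[a, b] < +oo)%E.
  by rewrite lebesgue_measure_itv /=; case: ifPn => // _; rewrite -EFinB ltry.
have [h_ [ch_ Ih_ /fine_cvgP[_ cv]]] :=
  approximation_continuous_integrable (measurable_itv _) fin Ig.
move/cvgr0Pnorm_le : cv => /(_ _ d0)[n _ /(_ n (leqnn n))] /= H.
exists (h_ n); split=> //.
by apply: le_trans H; rewrite ler_norm.
Qed.

Lemma continuous_bounded_cc f a b : continuous f ->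
  exists2 B : R, 0 <= B & forall x, a <= x <= b -> `|f x| <= B.
Proof.
move=> cf.
have cf' : {within `[a, b], continuous f} by exact: continuous_subspaceT.
have [M [_ mrt]] := compact_bounded (continuous_compact cf' (@segment_compact R a b)).
exists (`|M| + 1); first by rewrite addr_ge0.
move=> x abx; apply: (mrt (`|M| + 1)); last by exists x => //=; rewrite in_itv.
by rewrite (le_lt_trans (ler_norm M))// ltrDl.
Qed.

Lemma lipschitz_continuous (G' : R -> R) (K : R) :
  (forall y z : R, `|G' y - G' z| <= K * `|y - z|) -> continuous G'.
Proof.
move=> lip x; apply/cvgrPdist_le => e e0.
have B : 0 < `|K| + 1 by rewrite ltr_wpDl.
near=> y.
have : `|x - y| <= e / (`|K| + 1).
  by near: y; apply: cvgr_dist_le => //; rewrite divr_gt0.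
rewrite ler_pdivlMr// => h; apply: le_trans (lip x y) (le_trans _ h).
by rewrite mulrC ler_wpM2l// (le_trans (ler_norm _))// lerDl.
Unshelve. all: by end_near. Qed.

(** The restriction d <= 1 allows quadratic errors in d to be absorbed into the linear bound. *)
Lemma eq0_of_small_bound (X C : R) :
  (forall d : R, 0 < d -> d <= 1 -> `|X| <= C * d) -> X = 0.
Proof.
move=> H; apply/eqP; rewrite -normr_le0; apply/ler_addgt0Pr => e e0; rewrite add0r.
have C1 : 0 < `|C| + 1 by rewrite ltr_wpDl.
pose d := Num.min 1 (e / (`|C| + 1)).
have d0 : 0 < d by rewrite lt_min ltr01 divr_gt0.
have dle : d <= e / (`|C| + 1) by rewrite ge_min lexx orbT.
apply: le_trans (H d d0 _) _; first by rewrite ge_min lexx.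
rewrite ler_pdivlMr// in dle; apply: le_trans dle; rewrite mulrC ler_wpM2l// ?ltW//.
by rewrite (le_lt_trans (ler_norm _))// ltrDl.
Qed.

(** For continuous g this is the fundamental theorem of calculus. In general g is replaced on [a, b]
    by a continuous h at L^1 distance at most d; the primitive k of h with k a = f a stays within d
    of f, and the Lipschitz bound on G' makes all errors linear in d. *)
Lemma primitive_chain f g (c c' G G' : R -> R) (K : R) a b : primitive f g ->
  (forall x, is_derive x (1 : R) c (c' x)) -> continuous c' ->
  (forall y, is_derive y (1 : R) G (G' y)) ->
  (forall y z, `|G' y - G' z| <= K * `|y - z|) -> a <= b ->
  c b * G (f b) - c a * G (f a) =
  \int[mu]_(x in `[a, b]) (c' x * G (f x) + c x * (G' (f x) * g x)).
Proof.
move=> pf dc cc' dG lipG ab.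
have cc := is_derive_continuous dc; have cG := is_derive_continuous dG.
have cG' := lipschitz_continuous lipG.
have cf := primitive_continuous pf.
have K0 : 0 <= K.
  by have := lipG 0 1; rewrite sub0r normrN1 mulr1; apply: le_trans.
have [Ig _] := pf a b ab.
have [B1 B10 HB1] := @continuous_bounded_cc c a b cc.
have [B2 B20 HB2] := @continuous_bounded_cc c' a b cc'.
have [B3 B30 HB3] := @continuous_bounded_cc (G' \o f) a b (fun x => continuous_comp
  (cf x) (cG' (f x))).
have [B4 B40 HB4] := @continuous_bounded_cc (G \o f) a b (fun x => continuous_comp
  (cf x) (cG (f x))).
set N := \int[mu]_(x in `[a, b]) `|g x|.
have mab : measurable (`[a, b]%classic : set (measurableTypeR R)) by exact:
  measurable_itv.
have mcont h : continuous h -> measurable_fun (`[a, b]%classic : set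
  (measurableTypeR R)) h.
  by move=> ch; apply: intg_meas; apply: intg_cc_continuous.
have N0 : 0 <= N by apply: Rintegral_ge0.
have cGf : continuous (G \o f) by move=> x; exact: continuous_comp (cf x) (cG _).
have cG'f : continuous (G' \o f) by move=> x; exact: continuous_comp (cf x) (cG' _).
have IJ : intg `[a, b] (fun x => c' x * G (f x) + c x * (G' (f x) * g x)).
  apply: (@intg_le R `[a, b]%classic _ (fun x => B2 * B4 + B1 * B3 * `|g x|)) => //.
  - apply: measurable_funD; apply: measurable_funM.
    + exact: mcont.
    + exact: mcont.
    + exact: mcont.
    + by apply: measurable_funM; [exact: mcont|exact: intg_meas].
  - apply: intgD => //; first by apply: intg_cc_continuous; exact: cst_continuous.
    by apply: intgZ => //; exact: intg_norm.
  - move=> x; rewrite /= in_itv /= => abx.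
    apply: le_trans (ler_normD _ _) _; rewrite !normrM.
    apply: lerD; first by rewrite ler_pM// ?HB2// HB4.
    by rewrite mulrA ler_wpM2r// ler_pM// ?HB1// HB3.
apply/eqP; rewrite -subr_eq0; apply/eqP.
(* The two endpoint terms give (B1 + B1) (B3 + K); the integral gives, in order, the error in G, the
   error in G' against g, and the terms against g - h. *)
apply: (@eq0_of_small_bound _ ((B1 + B1) * (B3 + K) +
    (B2 * (B3 + K) * (b - a) + B1 * (K * N) + B1 * (K + B3)))).
move=> d d0 d1.
have [h [ch Hd]] := approx_L1 d0 Ig.
have Ih : intg `[a, b] h by exact: intg_cc_continuous.
have [k0 pk0] := @primitive_ex R h (fun x y => @intg_cc_continuous R x y h ch).
pose k x := k0 x - k0 a + f a.
have pk : primitive k h.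
  by move=> x y xy; have [? E] := pk0 x y xy; split=> //; rewrite -E /k; ring.
have ck := primitive_continuous pk.
have Igh : intg `[a, b] (fun x => `|g x - h x|).
  by apply: intg_norm; apply: intgB.
have kf x : a <= x <= b -> `|k x - f x| <= d.
  move=> /andP[ax xb]; apply: le_trans Hd.
  have [Ig1 E1] := pf a x ax; have [Ih1 E2] := pk a x ax.
  have -> : k x - f x = - ((f x - f a) - (k x - k a)) by rewrite /k; ring.
  rewrite normrN E1 E2 -RintegralB//.
  apply: le_trans (le_normr_Rintegral _ _) _ => //; first exact: intgB.
  apply: Rintegral_ge0_sub => //.
  by apply: subset_itvl; rewrite bnd_simp.
have Gkf x : a <= x <= b -> `|G (k x) - G (f x)| <= (B3 + K) * d.
  move=> abx; have := lipschitz_taylor dG lipG (k x) (f x).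
  have e1 := kf x abx; have e2 := HB3 x abx.
  set u := G (k x) - G (f x); set v := G' (f x) * (k x - f x).
  move=> e3; have -> : u = (u - v) + v by ring.
  rewrite (le_trans (ler_normD _ _))// addrC mulrDl; apply: lerD.
    by rewrite /v normrM ler_pM.
  apply: le_trans e3 _; rewrite ler_wpM2l// -real_normK ?num_real// expr2.
  by rewrite -[leRHS]mul1r ler_pM// (le_trans e1).
have dk x := @primitive_derive R k h x pk (ch x).
have cGk : continuous (G \o k) by move=> x; exact: continuous_comp (ck x) (cG _).
have cG'k : continuous (G' \o k) by move=> x; exact: continuous_comp (ck x) (cG' _).
pose j x := c' x * G (k x) + c x * (G' (k x) * h x).
have cj : continuous j.
  move=> x; apply: cvgD; apply: cvgM; [exact: cc'|exact: cGk|exact: cc|].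
  by apply: cvgM; [exact: cG'k|exact: ch].
have Ij : intg `[a, b] j by exact: intg_cc_continuous.
have [_ FTC] : intg `[a, b] j /\ c b * G (k b) - c a * G (k a) = \int[mu]_(x in
  `[a, b]) j x.
  apply: (@C1_primitive R (fun x => c x * G (k x)) j) => // x.
  have dGk : is_derive x (1 : R) (fun x => G (k x)) (G' (k x) * h x).
    exact: (@is_derive1_comp R G k x _ _ (dG (k x)) (dk x)).
  exact: is_derive_mul (dc x) dGk.
set LHS := (X in X - _).
set J := Rintegral _ _ _.
have -> : LHS - J = (c b * (G (f b) - G (k b)) - c a * (G (f a) - G (k a)))
   + (\int[mu]_(x in `[a, b]) j x - J).
  by rewrite -FTC /LHS; ring.
rewrite mulrDl; apply: le_trans (ler_normD _ _) _; apply: lerD.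
  rewrite (le_trans (ler_normB _ _))// !mulrDl; apply: lerD.
    rewrite normrM distrC -mulrA; apply: ler_pM => //.
      by apply: HB1; rewrite ab lexx.
    by apply: Gkf; rewrite ab lexx.
  rewrite normrM distrC -mulrA; apply: ler_pM => //.
    by apply: HB1; rewrite ab lexx.
  by apply: Gkf; rewrite ab lexx.
rewrite -RintegralB//.
have Ibig : intg `[a, b] (fun x => B2 * ((B3 + K) * d) + (B1 * (K * d) * `|g x| +
   B1 * (K * d + B3) * `|g x - h x|)).
  apply: intgD => //; first by apply: intg_cc_continuous; exact: cst_continuous.
  by apply: intgD => //; apply: intgZ => //; exact: intg_norm.
apply: le_trans (le_Rintegral_norm (g := (fun x => B2 * ((B3 + K) * d) + (B1 * (K *
  d) * `|g x| +
   B1 * (K * d + B3) * `|g x - h x|))) _ _ _ _) _ => //.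
- by apply: intg_meas; exact: intgB.
- move=> x; rewrite /= in_itv /= => abx.
  (* Writing h as g - (g - h) leaves only the integrals of |g|, which is N, and of |g - h|, which is
     at most d. *)
  have -> : j x - (c' x * G (f x) + c x * (G' (f x) * g x)) =
    c' x * (G (k x) - G (f x)) + c x * ((G' (k x) - G' (f x)) * (g x - (g x - h x))
      - G' (f x) * (g x - h x)) by rewrite /j; ring.
  apply: le_trans (ler_normD _ _) _; apply: lerD.
    by rewrite normrM ler_pM// ?HB2// Gkf.
  have e0 := kf x abx.
  have e1 : `|G' (k x) - G' (f x)| <= K * d.
    by apply: le_trans (lipG _ _) _; rewrite ler_wpM2l.
  have e2 := HB3 x abx.
  rewrite normrM -!mulrA -mulrDr ler_pM// ?HB1//.
  rewrite (le_trans (ler_normB _ _))// !normrM.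
  have e3 : `|G' (k x) - G' (f x)| * `|g x - (g x - h x)| <= K * d * (`|g x| + `|g
    x - h x|).
    by rewrite ler_pM// ler_normB.
  apply: le_trans (lerD e3 (ler_wpM2r _ e2)) _ => //.
  by rewrite le_eqVlt; apply/orP; left; apply/eqP; ring.
rewrite RintegralD//; last 2 first.
- by apply: intg_cc_continuous; exact: cst_continuous.
- by apply: intgD => //; apply: intgZ => //; exact: intg_norm.
rewrite RintegralD//; last 2 first.
- by apply: intgZ => //; exact: intg_norm.
- by apply: intgZ.
rewrite Rintegral_cst_cc//.
have -> : \int[mu]_(x in `[a, b]) (B1 * (K * d) * `|g x|) = B1 * (K * d) * N.
  by rewrite RintegralZl//; exact: intg_norm.
have -> : \int[mu]_(x in `[a, b]) (B1 * (K * d + B3) * `|g x - h x|) =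
    B1 * (K * d + B3) * \int[mu]_(x in `[a, b]) `|g x - h x|.
  by rewrite RintegralZl.
rewrite !mulrDl -!addrA.
have e4 : B1 * (K * d + B3) * \int[mu]_(x in `[a, b]) `|g x - h x| <= B1 * (K + B3)
  * d.
  rewrite ler_pM//.
  - by rewrite mulr_ge0// addr_ge0// mulr_ge0// ltW.
  - exact: Rintegral_ge0.
  - by rewrite ler_wpM2l// lerD2r -[leRHS]mulr1 ler_wpM2l.
lra.
Qed.

End Chain.

(** * Square-integrable functions *)

Section L2.
Context {R : realType}.
Implicit Types (f g h : R -> R) (a b c x y : R).
Local Notation mu := (@lebesgue_measure R).
Local Notation intg D f := (integrable mu D (EFin \o f)).
Local Notation L2 f := (f \in Lfun mu 2%:E).
Local Notation TR := (setT : set (measurableTypeR R)).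

Lemma L2_meas f : L2 f -> measurable_fun TR f.
Proof. by move=> /sub_Lfun_mfun; rewrite inE. Qed.

Lemma L2_sqr f : L2 f -> intg TR (fun x => f x ^+ 2).
Proof. exact: Lfun2_integrable_sqr. Qed.

Lemma L2P f : measurable_fun TR f -> intg TR (fun x => f x ^+ 2) -> L2 f.
Proof.
move=> mf If; rewrite inE; apply/andP; split; rewrite inE//=.
rewrite /finite_norm unlock /= poweR_lty//.
case/integrableP : If => _; apply: le_lt_trans; rewrite le_eqVlt; apply/orP; left.
apply/eqP; apply: eq_integral => x _ /=.
by rewrite powR_mulrn// real_normK ?num_real// ger0_norm// sqr_ge0.
Qed.

Let L2ge1 : ((1 : \bar R) <= 2%:E)%E. Proof. by rewrite lee_fin; lra. Qed.

Lemma L2D f g : L2 f -> L2 g -> L2 (fun x => f x + g x).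
Proof. by move=> lf lg; apply: (Lfun_addr_closed mu L2ge1).2 lf lg. Qed.

Lemma L2Z c f : L2 f -> L2 (fun x => c * f x).
Proof. by move=> lf; rewrite (_ : (fun x => _) = c \o* f); [apply: Lfun_scale =>
  //; lra|by apply/funext => x /=; rewrite mulrC]. Qed.

Lemma L2B f g : L2 f -> L2 g -> L2 (fun x => f x - g x).
Proof. by move=> lf lg; apply: L2D lf _; exact: Lfun_oppr_closed. Qed.

Lemma L2N f : L2 f -> L2 (fun x => - f x).
Proof. by move=> lf; apply: Lfun_oppr_closed. Qed.

Lemma L2_mul f g : L2 f -> L2 g -> intg TR (fun x => f x * g x).
Proof. by move=> lf lg; apply/Lfun1_integrable; exact: Lfun2_mul_Lfun1. Qed.

Lemma L2_le f g : measurable_fun TR f -> L2 g ->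
  (forall x, `|f x| <= `|g x|) -> L2 f.
Proof.
move=> mf lg fg; apply: L2P => //.
apply: (intg_le _ _ (L2_sqr lg)) => //; first exact: measurable_funX.
move=> x _; rewrite normrX -[g x ^+ 2]real_normK ?num_real//.
by rewrite lerXn2r ?nnegrE.
Qed.

Lemma L2_loc f a b : L2 f -> intg `[a, b] f.
Proof.
move=> lf; have mab : measurable (`[a, b]%classic : set (measurableTypeR R)) by
  exact: measurable_itv.
apply: (@intg_le R _ f (fun x => 1 + f x ^+ 2)) => //.
- by apply: measurable_funTS; exact: L2_meas.
- apply: intgD => //; first by apply: intg_cc_continuous; exact: cst_continuous.
  by apply: intg_sub (L2_sqr lf).
- move=> x _; rewrite -[f x ^+ 2]real_normK ?num_real//.
  have := sqr_ge0 (`|f x| - 1); have := normr_ge0 (f x); nra.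
Qed.

Definition sqnorm2 f := \int[mu]_x (f x ^+ 2).
Definition inner f g := \int[mu]_x (f x * g x).

Lemma sqnorm2_ge0 f : 0 <= sqnorm2 f.
Proof. by apply: Rintegral_ge0 => x _; exact: sqr_ge0. Qed.

Lemma sqnorm2Z c f : L2 f -> sqnorm2 (fun x => c * f x) = c ^+ 2 * sqnorm2 f.
Proof.
move=> lf; rewrite /sqnorm2 -RintegralZl//; last exact: L2_sqr.
by apply: eq_Rintegral => x _; rewrite exprMn.
Qed.

Lemma sqnorm2D_le f g : L2 f -> L2 g ->
  sqnorm2 (fun x => f x + g x) <= 2 * sqnorm2 f + 2 * sqnorm2 g.
Proof.
move=> lf lg; rewrite /sqnorm2 -!RintegralZl//; try exact: L2_sqr.
rewrite -RintegralD//; try by apply: intgZ => //; exact: L2_sqr.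
apply: le_Rintegral => //.
- by apply: L2_sqr; exact: L2D.
- by apply: intgD => //; apply: intgZ => //; exact: L2_sqr.
- by move=> x _; have := sqr_ge0 (f x - g x); nra.
Qed.

Lemma ae_eq_sqnorm2 f g : L2 f -> L2 g -> {ae mu, forall x, f x = g x} ->
  sqnorm2 f = sqnorm2 g.
Proof.
move=> lf lg fg; apply: ae_eq_Rintegral => //.
- by apply: measurable_funX; exact: L2_meas.
- by apply: measurable_funX; exact: L2_meas.
apply: ae_mono fg.
by move=> x -> _.
Qed.

(** The squared norm of f - t g is a nonnegative quadratic in t; its value at the minimiser t =
    inner f g / sqnorm2 g gives the inequality. *)
Lemma cauchy_schwarz f g : L2 f -> L2 g -> inner f g ^+ 2 <= sqnorm2 f * sqnorm2 g.
Proof.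
move=> lf lg.
have H (t : R) : 0 <= sqnorm2 f - 2 * t * inner f g + t ^+ 2 * sqnorm2 g.
  have -> : sqnorm2 f - 2 * t * inner f g + t ^+ 2 * sqnorm2 g = sqnorm2 (fun x =>
    f x - t * g x).
    rewrite /sqnorm2 /inner -!RintegralZl//; [|exact: L2_sqr|exact: L2_mul].
    rewrite -RintegralB//; [|exact: L2_sqr|by apply: intgZ => //; exact: L2_mul].
    rewrite -RintegralD//; last 2 first.
    - by apply: intgB => //; [exact: L2_sqr|by apply: intgZ => //; exact: L2_mul].
    - by apply: intgZ => //; exact: L2_sqr.
    by apply: eq_Rintegral => x _; ring.
  exact: sqnorm2_ge0.
have A0 := sqnorm2_ge0 f; have C0 := sqnorm2_ge0 g.
move: H A0 C0; move: (sqnorm2 f) (sqnorm2 g) (inner f g) => A C B H A0 C0.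
have [C1|C1] := eqVneq C 0.
  rewrite C1 mulr0; have [->|B0] := eqVneq B 0; first by rewrite expr0n.
  (* With C = 0 and B nonzero the quadratic degenerates to A - 2 t B, which this t makes equal to
     -1. *)
  have := H ((A + 1) / (2 * B)); rewrite C1 mulr0 addr0.
  have -> : 2 * ((A + 1) / (2 * B)) * B = A + 1 by field.
  lra.
have {}C0 : 0 < C by rewrite lt_neqAle eq_sym C1.
have := H (B / C).
have -> : A - 2 * (B / C) * B + (B / C) ^+ 2 * C = (A * C - B ^+ 2) / C by field.
by rewrite pmulr_lge0 ?invr_gt0// subr_ge0.
Qed.

Lemma Rintegral_exhaust h : intg TR h ->
  \int[mu]_(x in `[- n%:R, n%:R]) h x @[n --> \oo] --> \int[mu]_x h x.
Proof.
move=> Ih.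
have := @Rintegral_dominated R setT (fun n => h \_ `[- n%:R, n%:R]) h (fun x => `|h
  x|).
case=> //.
- move=> n; apply/(measurable_restrictT _ _).1 => //.
  by apply: measurable_funTS; exact: intg_meas.
- move=> x _; apply: cvg_near_cst.
  near=> n; rewrite patchE mem_set//= in_itv /=.
  have : `|x| <= n%:R by near: n; exact: nbhs_infty_ger.
  by rewrite ler_norml.
- exact: intg_norm.
- move=> n x _; rewrite patchE; case: ifPn => // _; by rewrite normr0.
move=> _; apply: cvg_trans; apply: near_eq_cvg; apply: nearW => n.
by rewrite -Rintegral_mkcond.
Unshelve. all: by end_near. Qed.

Lemma sqr_derive y : is_derive y (1 : R) (fun y : R => y ^+ 2) (2 * y).
Proof.
by have := is_derive_mul (is_derive_var y) (is_derive_var y) => /is_derive_congr;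
  apply; ring.
Qed.

(** For y in [x, x + 1], f x ^ 2 is f y ^ 2 minus the integral of 2 f g over [x, y], hence at most f
    y ^ 2 + S; averaging over y gives the bound. Its local form is what yields decay at infinity. *)
Lemma primitive_sup_local f g x : primitive f g -> L2 f -> L2 g ->
  f x ^+ 2 <= \int[mu]_(y in `[x, x + 1]) (2 * f y ^+ 2 + g y ^+ 2).
Proof.
move=> pf lf lg.
have x1 : x <= x + 1 by lra.
have If2 : intg `[x, x + 1] (fun y => f y ^+ 2) by apply: intg_sub (L2_sqr lf).
have Ig2 : intg `[x, x + 1] (fun y => g y ^+ 2) by apply: intg_sub (L2_sqr lg).
have Ifg : intg `[x, x + 1] (fun y => f y ^+ 2 + g y ^+ 2) by apply: intgD.
pose S := \int[mu]_(y in `[x, x + 1]) (f y ^+ 2 + g y ^+ 2).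
have Icst c : intg `[x, x + 1] (fun=> c).
  by apply: intg_cc_continuous; exact: cst_continuous.
have H y : y \in `[x, x + 1] -> f x ^+ 2 <= f y ^+ 2 + S.
  rewrite in_itv /= => /andP[xy yx].
  have := @primitive_chain R f g (fun=> 1) (fun=> 0) (fun y => y ^+ 2) (fun y => 2
    * y)
    2 x y pf (fun x => is_derive_const x 1) (@cst_continuous _ _ 0) sqr_derive _ xy.
  rewrite !mul1r => H.
  have {}H := H _; rewrite -[leRHS]addrC -lerBlDr -[leLHS]opprB lerNl H; last first.
    by move=> p q; rewrite -mulrBr normrM ger0_norm.
  have mxy : measurable (`[x, y]%classic : set (measurableTypeR R)) by exact:
    measurable_itv.
  have sub : `[x, y] `<=` `[x, x + 1] by apply: subset_itvl; rewrite bnd_simp.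
  apply: (@le_trans _ _ (- \int[mu]_(z in `[x, y]) (f z ^+ 2 + g z ^+ 2))).
    rewrite lerN2; apply: Rintegral_ge0_sub => // z _.
    by rewrite addr_ge0// sqr_ge0.
  rewrite -mulN1r -RintegralZl//; last exact: intg_sub Ifg.
  apply: le_Rintegral => //.
  - by apply: intgZ => //; exact: intg_sub Ifg.
  - apply: (@intg_le R _ _ (fun z => f z ^+ 2 + g z ^+ 2)) => //.
    + rewrite (_ : (fun z => _) = (fun z => 2 * (f z * g z))); last first.
        by apply/funext => z; ring.
      by apply: intg_meas; apply: intgZ => //; apply: intg_sub (L2_mul lf lg).
    + exact: intg_sub Ifg.
    + move=> z _; rewrite ler_norml; apply/andP; split.
        by have := sqr_ge0 (f z + g z); nra.
      by have := sqr_ge0 (f z - g z); nra.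
  - by move=> z _; have := sqr_ge0 (f z + g z); nra.
have -> : f x ^+ 2 = \int[mu]_(y in `[x, x + 1]) (f x ^+ 2).
  by rewrite Rintegral_cst_cc//; ring.
have -> : \int[mu]_(y in `[x, (x + 1)%R]) (2 * f y ^+ 2 + g y ^+ 2) =
    \int[mu]_(y in `[x, (x + 1)%R]) (f y ^+ 2 + S).
  rewrite [RHS]RintegralD// Rintegral_cst_cc//.
  have -> : S * (x + 1 - x) = S by ring.
  rewrite /S -RintegralD//.
  by apply: eq_Rintegral => y _; ring.
apply: le_Rintegral => //; first exact: intgD.
Qed.

Lemma primitive_sup f g x : primitive f g -> L2 f -> L2 g ->
  f x ^+ 2 <= 2 * sqnorm2 f + sqnorm2 g.
Proof.
move=> pf lf lg; apply: le_trans (primitive_sup_local x pf lf lg) _.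
rewrite /sqnorm2 -RintegralZl//; last exact: L2_sqr.
have I1 := intgZ 2 (@measurableT _ (measurableTypeR R)) (L2_sqr lf).
rewrite -RintegralD//; last exact: L2_sqr.
apply: Rintegral_ge0_sub => //.
- by apply: intgD => //; exact: L2_sqr.
- by move=> y _; have := sqr_ge0 (f y); have := sqr_ge0 (g y); lra.
Qed.

(** The integrals of q over [- n, n] converge, so their increments tend to 0, and these dominate the
    integrals over the unit intervals starting at n + 1 and at - (n + 1). The local bound looks to
    the right, whence the index n + 1: starting at - n, the interval would lie inside [- n, n]. *)
Lemma primitive_vanish f g : primitive f g -> L2 f -> L2 g ->
  (f n.+1%:R ^+ 2 @[n --> \oo] --> (0 : R)) /\
  (f (- n.+1%:R) ^+ 2 @[n --> \oo] --> (0 : R)).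
Proof.
move=> pf lf lg.
pose q x := 2 * f x ^+ 2 + g x ^+ 2.
have Iq : intg TR q by apply: intgD => //; [apply: intgZ => //|]; exact: L2_sqr.
have q0 x : 0 <= q x by rewrite /q; have := sqr_ge0 (f x); have := sqr_ge0 (g x); lra.
have cv := Rintegral_exhaust Iq.
pose I n := \int[mu]_(x in `[- n%:R, n%:R]) q x.
have cI : I n.+2 - I n @[n --> \oo] --> (0 : R).
  rewrite -(subrr (\int[mu]_x q x)); apply: cvgB => //.
  by have := cv; rewrite -(cvg_shiftn 2) /=; under eq_fun do rewrite addn2.
have Ic a b : intg `[a, b] q by apply: intg_sub Iq.
have K n : I n.+2 - I n = \int[mu]_(x in `[- n.+2%:R, - n%:R]) q x + \int[mu]_(x in
  `[n%:R, n.+2%:R]) q x.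
  rewrite /I (@Rintegral_cat R (- n.+2%:R) (- n%:R) n.+2%:R)//.
  - rewrite (@Rintegral_cat R (- n%:R) n%:R n.+2%:R)//; first by ring.
    + by rewrite ge0_cp.
    + by rewrite ler_nat; do 2 apply: leqW.
  - by rewrite lerN2 ler_nat; do 2 apply: leqW.
  - by rewrite (@le_trans _ _ 0)// oppr_le0.
have P a b : 0 <= \int[mu]_(x in `[a, b]) q x by apply: Rintegral_ge0.
split.
- apply: (squeeze_cvgr _ (cvg_cst 0) cI); apply: nearW => n.
  rewrite sqr_ge0 /= K; apply: le_trans (primitive_sup_local _ pf lf lg) _.
  apply: le_trans (_ : _ <= \int[mu]_(x in `[n%:R, n.+2%:R]) q x) _; last by
    rewrite lerDr.
  apply: Rintegral_ge0_sub => //; [|by move=> z _; exact: q0].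
  rewrite -[n.+2]addn1 natrD.
  by apply: subset_itvr; rewrite bnd_simp ler_nat.
- apply: (squeeze_cvgr _ (cvg_cst 0) cI); apply: nearW => n.
  rewrite sqr_ge0 /= K; apply: le_trans (primitive_sup_local _ pf lf lg) _.
  apply: le_trans (_ : _ <= \int[mu]_(x in `[- n.+2%:R, - n%:R]) q x) _; last by
    rewrite lerDl.
  have -> : - n.+1%:R + 1 = - n%:R :> R by rewrite -natr1; ring.
  apply: Rintegral_ge0_sub => //; [|by move=> z _; exact: q0].
  by apply: subset_itvr; rewrite bnd_simp lerN2 ler_nat.
Qed.

(** The growth bounds on G and G' make both integrands integrable and the boundary terms at most M f
    ^ 2, which vanishes along the integers. *)
Lemma primitive_whole f g (c c' G G' : R -> R) (M C K : R) :
  primitive f g -> L2 f -> L2 g ->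
  (forall x, is_derive x (1 : R) c (c' x)) -> continuous c' ->
  (forall x, `|c x| <= M) -> (forall x, `|c' x| <= C) ->
  (forall y, is_derive y (1 : R) G (G' y)) ->
  (forall y z : R, `|G' y - G' z| <= K * `|y - z|) ->
  (forall y, `|G y| <= y ^+ 2) -> (forall y, `|G' y| <= 2 * `|y|) ->
  [/\ intg TR (fun x => c' x * G (f x)),
      intg TR (fun x => c x * (G' (f x) * g x)) &
   \int[mu]_x (c x * (G' (f x) * g x)) = - \int[mu]_x (c' x * G (f x))].
Proof.
move=> pf lf lg dc cc' cM cC dG lipG GG GG'.
have cont_meas h : continuous h -> measurable_fun TR h.
  by move=> ch; exact: continuous_measurable_fun.
have cf := primitive_continuous pf.
have cc := is_derive_continuous dc; have cG := is_derive_continuous dG.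
have cG' := lipschitz_continuous lipG.
have I1 : intg TR (fun x => c' x * G (f x)).
  apply: (intg_le (g := fun x => C * f x ^+ 2)) => //.
  - apply: measurable_funM; apply: cont_meas => // x.
    exact: continuous_comp (cf x) (cG _).
  - by apply: intgZ => //; exact: L2_sqr.
  - by move=> x _; rewrite normrM ler_pM.
have I2 : intg TR (fun x => c x * (G' (f x) * g x)).
  apply: (intg_le (g := fun x => M * (2 * `|f x * g x|))) => //.
  - apply: measurable_funM; first exact: cont_meas.
    apply: measurable_funM; last exact: L2_meas.
    by apply: cont_meas => x; exact: continuous_comp (cf x) (cG' _).
  - by do 2 apply: intgZ => //; apply: intg_norm; exact: L2_mul.
  - move=> x _; rewrite normrM ler_pM// normrM [`|f x * _|]normrM mulrA.
    by rewrite ler_wpM2r.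
split=> //; apply/eqP; rewrite -addr_eq0 addrC -RintegralD//; apply/eqP.
have [v1 v2] := primitive_vanish pf lf lg.
have := Rintegral_exhaust (intgD measurableT I1 I2).
rewrite -(cvg_shiftn 1) /= => cv.
apply: cvg_unique cv _ => //.
have cG0 (s : nat -> R) : f (s n) ^+ 2 @[n --> \oo] --> (0 : R) ->
    c (s n) * G (f (s n)) @[n --> \oo] --> (0 : R).
  move=> cs; apply: norm_cvg0.
  have cs' : M * f (s n) ^+ 2 @[n --> \oo] --> (0 : R).
    by rewrite -(mulr0 M); apply: cvgMr.
  apply: (squeeze_cvgr _ (cvg_cst 0) cs'); apply: nearW => n.
  by rewrite normr_ge0 normrM ler_pM.
have cv0 : c n.+1%:R * G (f n.+1%:R) - c (- n.+1%:R) * G (f (- n.+1%:R))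
    @[n --> \oo] --> (0 : R).
  rewrite -(subrr (0 : R)); apply: cvgB.
    exact: (cG0 (fun n => n.+1%:R) v1).
  exact: (cG0 (fun n => - n.+1%:R) v2).
apply: cvg_trans cv0; apply: near_eq_cvg; apply: nearW => n /=.
rewrite (primitive_chain pf dc cc' dG lipG) ?addn1//.
by rewrite (@le_trans _ _ 0)// oppr_le0.
Qed.

End L2.

(** * Test functions *)

Section TestFunctions.
Context {R : realType}.
Implicit Types (f g h w : R -> R) (a b c x y : R).
Local Notation mu := (@lebesgue_measure R).
Local Notation intg D f := (integrable mu D (EFin \o f)).
Local Notation TR := (setT : set (measurableTypeR R)).

Lemma is_derive_quotient f x (l : R) :
  (f (h + x) - f x) / h @[h --> (0 : R)^'] --> l -> is_derive x (1 : R) f l.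
Proof.
move=> H.
have H' : h^-1 *: ((f \o shift x) (h *: (1 : R)) - f x) @[h --> (0 : R)^'] --> l.
  apply: cvg_trans H; apply: near_eq_cvg; apply: nearW => h /=.
  by rewrite /GRing.scale /= mulr1 mulrC.
apply: DeriveDef; first by apply/cvg_ex; exists l.
exact: cvg_lim H'.
Qed.

Lemma is_derive_pow n f x (a : R) : is_derive x (1 : R) f a ->
  is_derive x (1 : R) (fun y => f y ^+ n) (n%:R * f x ^+ n.-1 * a).
Proof.
move=> df; elim: n => [|n IH].
  by rewrite !mul0r; under eq_fun do rewrite expr0; exact: is_derive_const.
under eq_fun do rewrite exprS.
apply: is_derive_congr (is_derive_mul df IH) _; rewrite -natr1 /=.
by case: n {IH} => [|n] /=; rewrite ?exprS; ring.
Qed.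

(** The powers of 1 / x make the family generated by exp (- 1 / x) stable under differentiation. *)
Definition flat_fun n x := if 0 < x then x^-1 ^+ n * expR (- x^-1) else 0.

(** From exp y >= y ^ (n + 2) / (n + 2)! at y = 1 / x. The order 2 at the origin is what makes the
    derivative vanish there. *)
Lemma flat_bound n x : 0 <= flat_fun n x <= (n.+2)`!%:R * x ^+ 2.
Proof.
rewrite /flat_fun; case: ifPn => [x0|_]; last by rewrite lexx /= mulr_ge0// sqr_ge0.
have y0 : 0 < x^-1 by rewrite invr_gt0.
rewrite (mulr_ge0 (exprn_ge0 _ (ltW y0)) (expR_ge0 _)) /=.
rewrite expRN ler_pdivrMr ?expR_gt0//.
have := expR_ge1Dxn n.+1 (ltW y0).
have f0 : 0 < (n.+2)`!%:R :> R by rewrite ltr0n fact_gt0.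
move=> H; have {}H : x^-1 ^+ n.+2 / (n.+2)`!%:R <= expR x^-1 by lra.
rewrite ler_pdivrMr// in H.
have -> : x^-1 ^+ n = x^-1 ^+ n.+2 * x ^+ 2.
  by rewrite !exprS expr0; field; rewrite gt_eqF.
apply: le_trans (ler_wpM2r (sqr_ge0 x) H) _.
by rewrite le_eqVlt; apply/orP; left; apply/eqP; ring.
Qed.

Lemma flat_derive n x :
  is_derive x (1 : R) (flat_fun n) (flat_fun n.+2 x - n%:R * flat_fun n.+1 x).
Proof.
have [x0|x0|->] := ltgtP x 0.
- rewrite /flat_fun ltNge ltW//= mulr0 subrr; apply: (is_derive_near
    (is_derive_const x 0)).
  have : nbhs x `]x - 1, 0[%classic by apply: nbhs_itvoo => //; lra.
  by apply: filterS => y; rewrite /= in_itv /= => /andP[_ y0]; rewrite ltNge ltW.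
- have xn0 : x != 0 by rewrite gt_eqF.
  have dV : is_derive x (1 : R) (fun y : R => y^-1) (- x ^- 2).
    have := is_deriveV xn0 (is_derive_var x).
    by rewrite /GRing.scale /= mulr1.
  have dX : is_derive x (1 : R) (fun y : R => y^-1 ^+ n) (n%:R * x^-1 ^+ n.-1 * - x
    ^- 2).
    exact: (is_derive_pow n dV).
  have dE : is_derive x (1 : R) (fun y : R => expR (- y^-1)) (expR (- x^-1) * - (-
    x ^- 2)).
    exact: (is_derive_comp_fun (is_derive_expR _) (is_derive_opp dV)).
  have := is_derive_mul dX dE => /(is_derive_near (g := flat_fun n)).
  have E : \forall y \near x, y^-1 ^+ n * expR (- y^-1) = flat_fun n y.
    have : nbhs x `]0, (x + 1)[%classic by apply: nbhs_itvoo => //; lra.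
    by apply: filterS => y; rewrite /= in_itv /= => /andP[y0 _]; rewrite /flat_fun y0.
  move=> /(_ E) /is_derive_congr; apply; rewrite /flat_fun x0 -exprVn.
  case: n {dX E} => [|n] /=; first by rewrite !exprS !expr0; field.
  by rewrite !exprS; ring.
- rewrite {2 3}/flat_fun ltxx mulr0 subrr.
  apply: is_derive_quotient.
  apply: norm_cvg0; apply: (squeeze_cvgr (f := cst 0) (h := fun h : R =>
    (n.+2)`!%:R * `|h|)).
  + near=> h; rewrite normr_ge0 /= addr0 /flat_fun ltxx subr0 -/(flat_fun n h).
    have hn0 : h != 0 by near: h; exact: nbhs_dnbhs_neq.
    have /andP[p0 pb] := flat_bound n h.
    rewrite normrM normfV ler_pdivrMr ?normr_gt0// ger0_norm//.
    by rewrite -mulrA -expr2 real_normK ?num_real.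
  + exact: cvg_cst.
  + have H0 : (n.+2)`!%:R * `|h| @[h --> (0 : R)] --> (n.+2)`!%:R * `|0 : R|.
      by apply: cvgMr; exact: cvg_norm.
    rewrite normr0 mulr0 in H0; apply: cvg_trans H0.
    by apply: cvg_app; exact: nbhs_dnbhs.
Unshelve. all: by end_near. Qed.

(* An algebra closed under differentiation, hence made of smooth functions. *)
Inductive flat_poly : (R -> R) -> Prop :=
| flat_poly_cst c : flat_poly (fun=> c)
| flat_poly_flat n a b : flat_poly (fun x => flat_fun n (a * x + b))
| flat_poly_add f g : flat_poly f -> flat_poly g -> flat_poly (fun x => f x + g x)
| flat_poly_mul f g : flat_poly f -> flat_poly g -> flat_poly (fun x => f x * g x).

Lemma flat_poly_derive f : flat_poly f ->
  exists2 g, flat_poly g & forall x, is_derive x (1 : R) f (g x).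
Proof.
elim=> [c|n a b|{}f g _ [f' pf' df] _ [g' pg' dg]|{}f g pf [f' pf' df] pg [g' pg'
  dg]].
- by exists (fun=> 0); [exact: flat_poly_cst|move=> x; exact: is_derive_const].
- exists (fun x => (flat_fun n.+2 (a * x + b) + (- n%:R) * flat_fun n.+1 (a * x +
    b)) * a).
    apply: flat_poly_mul; last exact: flat_poly_cst.
    apply: flat_poly_add; first exact: flat_poly_flat.
    by apply: flat_poly_mul; [exact: flat_poly_cst|exact: flat_poly_flat].
  move=> x; have da : is_derive x (1 : R) (fun y => a * y + b) a.
    by apply: is_derive_congr (is_derive_add (is_derive_scale a (is_derive_var x))
      (is_derive_const x b)) _; ring.
  by apply: is_derive_congr (is_derive_comp_fun (flat_derive n _) da) _; ring.
- by exists (fun x => f' x + g' x); [exact: flat_poly_add|move=> x; exact: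
    is_derive_add].
- exists (fun x => f' x * g x + f x * g' x); last by move=> x; exact: is_derive_mul.
  by apply: flat_poly_add; exact: flat_poly_mul.
Qed.

Lemma flat_poly_continuous f : flat_poly f -> continuous f.
Proof. by move=> /flat_poly_derive[g _]; exact: is_derive_continuous. Qed.

Lemma is_derive_derive1 f g : (forall x, is_derive x (1 : R) f (g x)) -> derive1 f
  = g.
Proof. by move=> df; apply/funext => x; rewrite derive1E derive_val. Qed.

Lemma flat_poly_smooth f : flat_poly f -> forall n x, derivable (derive1n n f) x 1.
Proof.
move=> pf n; elim: n f pf => [|n IH] f pf x.
  by have [g _ dg] := flat_poly_derive pf.
have [g pg dg] := flat_poly_derive pf.
by rewrite /derive1n iterSr (is_derive_derive1 dg); exact: IH.
Qed.

Definition supported f a b := forall x, ~ (a <= x <= b) -> f x = 0.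

Lemma supported_compact f a b : supported f a b -> compactly_supported f.
Proof.
move=> sf; apply: (@subclosed_compact _ _ `[a, b]%classic).
- exact: closed_closure.
- exact: segment_compact.
rewrite (_ : `[a, b]%classic = closure `[a, b]%classic).
  apply: closure_subset => x /= /eqP fx; rewrite in_itv /=.
  by apply: contrapT => abx; apply: fx; exact: sf.
by apply/closure_id; exact: interval_closed.
Qed.

Lemma compact_supported f : compactly_supported f ->
  exists a b, a < b /\ supported f a b.
Proof.
move=> /compact_bounded[M [_ HM]].
have {HM} := HM (`|M| + 1); rewrite (le_lt_trans (ler_norm M)) ?ltrDl// => /(_ isT)
  HM.
exists (- (`|M| + 1)), (`|M| + 1); split; first by have := normr_ge0 M; lra.
move=> x xM; apply: contrapT => /eqP fx; apply: xM.
by rewrite -ler_norml; apply: HM; exact: subset_closure.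
Qed.

Lemma Rintegral_supported f a b : supported f a b ->
  \int[mu]_x f x = \int[mu]_(x in `[a, b]) f x.
Proof.
move=> sf; rewrite [RHS]Rintegral_mkcond; apply: eq_Rintegral => x _.
rewrite patchE; case: ifPn => //; rewrite notin_setE /= in_itv /= => nx.
exact: sf.
Qed.

Lemma intg_supported f a b : supported f a b -> intg `[a, b] f -> intg TR f.
Proof.
move=> sf If; 
have mab : measurable (`[a, b]%classic : set (measurableTypeR R)) by exact:
  measurable_itv.
have := (@integrable_mkcond _ _ _ mu _ (EFin \o f) mab).1 If.
apply: eq_integrable => // x _ /=.
rewrite patchE; case: ifPn => //; rewrite notin_setE /= in_itv /= => nx.
by rewrite sf.
Qed.

(** Positive exactly on ]a, b[; the affine arguments have the shape required by [flat_poly_flat]. *)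
Definition smooth_bump a b x := flat_fun 0 (1 * x + - a) * flat_fun 0 (-1 * x + b).

Lemma bump_poly a b : flat_poly (smooth_bump a b).
Proof. by apply: flat_poly_mul; exact: flat_poly_flat. Qed.

Lemma flat0_bound x : 0 <= flat_fun 0 x <= 1.
Proof.
rewrite /flat_fun; case: ifPn => x0; last by rewrite lexx ler01.
rewrite expr0 mul1r expR_ge0 /= -[leRHS]expR0 ler_expR.
by rewrite oppr_le0 invr_ge0 ltW.
Qed.

Lemma bump_bound a b x : 0 <= smooth_bump a b x <= 1.
Proof.
have /andP[a0 a1] := flat0_bound (1 * x + - a).
have /andP[b0 b1] := flat0_bound (-1 * x + b).
by rewrite /smooth_bump mulr_ge0//= mulr_ile1.
Qed.

Lemma bump_gt0 a b x : a < x < b -> 0 < smooth_bump a b x.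
Proof.
move=> /andP[ax xb]; rewrite /smooth_bump /flat_fun !expr0 !mul1r mulN1r subr_gt0
  ax [- x + b]addrC subr_gt0 xb.
by rewrite mulr_gt0// expR_gt0.
Qed.

Lemma bump_eq0 a b x : ~ (a < x < b) -> smooth_bump a b x = 0.
Proof.
move=> /negP; rewrite negb_and -!leNgt /smooth_bump /flat_fun mul1r mulN1r subr_gt0
  [- x + b]addrC subr_gt0.
by case/orP => h; [rewrite [a < x]ltNge h /= mul0r|rewrite [x < b]ltNge h /= mulr0].
Qed.

(* Polynomial in the bump, and convergent to the indicator of ]a, b[. *)
Definition plateau a b n x := 1 - (1 - smooth_bump a b x) ^+ n.

Lemma plateau_poly a b n : flat_poly (plateau a b n).
Proof.
have p1 : flat_poly (fun x => 1 + (-1) * smooth_bump a b x).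
  apply: flat_poly_add; first exact: flat_poly_cst.
  by apply: flat_poly_mul; [exact: flat_poly_cst|exact: bump_poly].
have pn : flat_poly (fun x => (1 + (-1) * smooth_bump a b x) ^+ n).
  elim: n => [|n IH]; first by under eq_fun do rewrite expr0; exact: flat_poly_cst.
  by under eq_fun do rewrite exprS; exact: flat_poly_mul.
rewrite (_ : plateau a b n = fun x => 1 + (-1) * (1 + (-1) * smooth_bump a b x) ^+ n).
  apply: flat_poly_add; first exact: flat_poly_cst.
  by apply: flat_poly_mul => //; exact: flat_poly_cst.
by apply/funext => x; rewrite /plateau !mulN1r.
Qed.

Lemma plateau_eq0 a b n x : ~ (a < x < b) -> plateau a b n x = 0.
Proof. by move=> h; rewrite /plateau bump_eq0// subr0 expr1n subrr. Qed.

Lemma plateau_supported a b n : supported (plateau a b n) a b.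
Proof.
by move=> x nx; apply: plateau_eq0 => /andP[ax xb]; apply: nx; rewrite !ltW.
Qed.

Lemma plateau_bound a b n x : `|plateau a b n x| <= 1.
Proof.
have /andP[p0 p1] := bump_bound a b x.
have q0 : 0 <= (1 - smooth_bump a b x) ^+ n by rewrite exprn_ge0// subr_ge0.
have q1 : (1 - smooth_bump a b x) ^+ n <= 1.
  by rewrite exprn_ile1// ?subr_ge0// gerBl.
by rewrite /plateau ger0_norm; lra.
Qed.

Lemma plateau_cvg a b x : a < x < b -> plateau a b n x @[n --> \oo] --> (1 : R).
Proof.
move=> /bump_gt0 p0; rewrite -[X in _ --> X]subr0; apply: cvgB; first exact: cvg_cst.
apply: cvg_expr; have /andP[_ p1] := bump_bound a b x.
by rewrite ger0_norm; lra.
Qed.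

(** The plateaus are bounded by 1 and tend to 1 on ]a, b[, so dominated convergence passes from them
    to the integral over the interval. *)
Lemma null_of_plateau w : (forall a b, intg `[a, b] w) ->
  (forall a b n, a < b -> \int[mu]_x (w x * plateau a b n x) = 0) ->
  forall a b, a <= b -> \int[mu]_(x in `[a, b]) w x = 0.
Proof.
move=> Iw H a b; rewrite le_eqVlt => /predU1P[->|ab].
  by rewrite set_itv1 Rintegral_set1.
pose D := (`]a, b[%classic : set (measurableTypeR R)).
have mD : measurable D by exact: measurable_itv.
have ID : intg D w by apply: intg_sub (Iw a b) => //; exact: subset_itv_oo_cc.
have E : \int[mu]_(x in `[a, b]) w x = \int[mu]_(x in D) w x.
  rewrite -(Rintegral_itv_obnd_cbnd (r := a)) -?(Rintegral_itv_bndo_bndc (r := b))//.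
  - by apply: intg_sub (Iw a b) => //; exact: subset_itv_oc_cc.
rewrite E.
have := @Rintegral_dominated R D (fun n x => w x * plateau a b n x) w (fun x => `|w
  x|) mD.
case.
- move=> n; apply: measurable_funM; first exact: intg_meas.
  apply: measurable_funTS; apply: continuous_measurable_fun.
  by apply: flat_poly_continuous; exact: plateau_poly.
- move=> x; rewrite /D /= in_itv /= => abx.
  by rewrite -[X in _ --> X]mulr1; apply: cvgMr; exact: plateau_cvg.
- exact: intg_norm.
- by move=> n x _; rewrite normrM ler_piMr// plateau_bound.
move=> _ cv; apply: cvg_unique cv _ => //.
rewrite (_ : (fun n => _) = cst 0); first exact: cvg_cst.
apply/funext => n /=; rewrite -(H a b n ab) [LHS]Rintegral_mkcond.
apply: eq_Rintegral => x _; rewrite patchE; case: ifPn => //.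
by rewrite notin_setE /D /= in_itv /= => nx; rewrite plateau_eq0// mulr0.
Qed.

(** By Lebesgue differentiation w is a.e. the derivative of its integral from - n, which is
    constantly 0 beyond - n; countably many such half-lines cover the line. *)
Lemma ae0_of_null w : measurable_fun TR w -> (forall a b, intg `[a, b] w) ->
  (forall a b, a <= b -> \int[mu]_(x in `[a, b]) w x = 0) ->
  {ae mu, forall x, w x = 0}.
Proof.
move=> mw Iw H.
have lw : locally_integrable [set: R] w.
  split=> //; first exact: openT.
  move=> K _ cK; have [M [_ HM]] := compact_bounded cK.
  have {HM} := HM (`|M| + 1); rewrite (le_lt_trans (ler_norm M)) ?ltrDl// => /(_
    isT) HM.
  have KM : K `<=` `[- (`|M| + 1), `|M| + 1].
    by move=> x Kx; rewrite /= in_itv /= -ler_norml; exact: HM.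
  have mK : measurable (K : set (measurableTypeR R)) by exact: compact_measurable.
  have : intg K w by exact: intg_sub (measurable_itv _) mK KM (Iw _ _).
  by case/integrableP.
have A (n : nat) : {ae mu, forall x, - n%:R < x -> w x = 0}.
  have := @FTC1 R w (BLeft (- n%:R)) (fun y => Iw _ _) lw.
  apply: ae_mono.
  move=> x /= Hx nx; move: Hx; rewrite lte_fin => /(_ nx)[_ <-].
  rewrite derive1E; have d0 : is_derive x (1 : R) (fun y : R => \int[mu]_(t in `[-
    n%:R, y]) w t) (0 : R).
    apply: (is_derive_near (is_derive_const x 0)).
    have : nbhs x `](- n%:R), (x + 1)[%classic by apply: nbhs_itvoo => //; lra.
    by apply: filterS => y; rewrite /= in_itv /= => /andP[y0 _]; rewrite H// ltW.
  exact: derive_val.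
have := ae_foralln A; apply: ae_mono.
move=> x Hx; have [n _ Hn] := nbhs_infty_gtr (`|x|).
apply: (Hx n); rewrite ltrNl; apply: le_lt_trans (Hn n (leqnn n)).
by rewrite -normrN ler_norm.
Qed.

(** The zero function is a primitive of w, and where w is continuous a primitive has derivative w
    x. *)
Lemma continuous_ae0 w : continuous w -> {ae mu, forall x, w x = 0} ->
  forall x, w x = 0.
Proof.
move=> cw w0 x.
have Iw a b : intg `[a, b] w by exact: intg_cc_continuous.
have p : primitive (fun=> 0) w.
  move=> a b ab; split=> //; rewrite subrr -(mul0r (b - a)) -Rintegral_cst_cc//.
  apply: ae_eq_Rintegral => //; first exact: intg_meas.
  apply: ae_mono w0.
  by move=> y ->.
have d1 := primitive_derive p (cw x); have d2 := is_derive_const x (0 : R).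
by rewrite -(@derive_val _ _ _ _ _ _ _ d1) (@derive_val _ _ _ _ _ _ _ d2).
Qed.

End TestFunctions.

(** * Weak derivatives *)

Section WeakDerivatives.
Context {R : realType}.
Implicit Types (f g h w phi : R -> R) (a b c x y : R).
Local Notation mu := (@lebesgue_measure R).
Local Notation intg D f := (integrable mu D (EFin \o f)).
Local Notation TR := (setT : set (measurableTypeR R)).
Local Notation L2 f := (f \in Lfun mu 2%:E).

Lemma test_function_plateau a b n : test_function (plateau a b n).
Proof.
split; first exact: flat_poly_smooth (plateau_poly a b n).
by apply: (@supported_compact R _ a b); exact: plateau_supported.
Qed.

Lemma test_function_derive1 phi : test_function phi ->
  [/\ test_function (derive1 phi), (forall x, is_derive x (1 : R) phi (derive1 phi
    x)) &
      continuous (derive1 phi)].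
Proof.
move=> [sm cs]; have D x : is_derive x (1 : R) phi (derive1 phi x).
  by apply: DeriveDef; [exact: (sm 0)|rewrite derive1E].
have cd : continuous (derive1 phi).
  by move=> x; apply: differentiable_continuous; apply/derivable1_diffP; exact: (sm
    1).
suff td : test_function (derive1 phi) by [].
split=> [n x|]; first by have := sm n.+1 x; rewrite /derive1n iterSr.
have [a [b [ab sf]]] := compact_supported cs.
apply: (@supported_compact _ _ a b) => x xab.
(* Off [a, b] the function phi vanishes on a whole neighbourhood, so its derivative is 0 there
   too. *)
have d0 : is_derive x (1 : R) phi 0.
  apply: (is_derive_near (is_derive_const x 0)).
  have [xa|xa] := ltP x a.
    have : nbhs x `](x - 1), a[%classic by apply: nbhs_itvoo => //; lra.
    apply: filterS => y; rewrite /= in_itv /= => /andP[_ ya].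
    by rewrite sf// => /andP[]; rewrite leNgt ya.
  have bx : b < x by rewrite ltNge; apply/negP => xb; apply: xab; rewrite xa.
  have : nbhs x `]b, (x + 1)[%classic by apply: nbhs_itvoo => //; lra.
  apply: filterS => y; rewrite /= in_itv /= => /andP[yb _].
  by rewrite sf// => /andP[_]; rewrite leNgt yb.
by rewrite derive1E derive_val.
Qed.

Lemma test_function_continuous phi : test_function phi -> continuous phi.
Proof. by move=> /test_function_derive1[_ d _]; exact: is_derive_continuous d. Qed.

Lemma intg_mul_supported w phi a b : supported phi a b -> continuous phi ->
  intg `[a, b] w -> intg TR (fun x => w x * phi x).
Proof.
move=> sp cphi Iw; apply: (@intg_supported R _ a b).
  by move=> x nx; rewrite sp// mulr0.
have [B B0 HB] := continuous_bounded_cc a b cphi.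
apply: (@intg_le R _ _ (fun x => B * `|w x|)) => //.
- apply: measurable_funM; first exact: intg_meas.
  by apply: measurable_funTS; exact: continuous_measurable_fun.
- by apply: intgZ => //; exact: intg_norm.
- by move=> x; rewrite /= in_itv /= => abx; rewrite normrM mulrC ler_wpM2r// HB.
Qed.

Lemma intg_mul_test w phi : (forall a b, intg `[a, b] w) -> test_function phi ->
  intg TR (fun x => w x * phi x).
Proof.
move=> Iw tphi; have [a [b [_ sf]]] := compact_supported tphi.2.
exact: intg_mul_supported sf (test_function_continuous tphi) (Iw a b).
Qed.

(* The mean of [w] against a fixed unit-mass bump is the constant: subtracting
   from a test function its mass times that bump leaves the derivative of a
   test function. *)
Lemma du_bois_reymond w : (forall a b, intg `[a, b] w) ->
  (forall phi, test_function phi -> \int[mu]_x (w x * derive1 phi x) = 0) ->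
  exists c, forall a b, a <= b -> \int[mu]_(x in `[a, b]) (w x - c) = 0.
Proof.
move=> Iw H.
pose m := \int[mu]_x smooth_bump 0 1 x.
have sB : supported (@smooth_bump R 0 1) 0 1.
  by move=> x nx; apply: bump_eq0 => /andP[x0 x1]; apply: nx; rewrite !ltW.
have cB : continuous (@smooth_bump R 0 1) by apply: flat_poly_continuous; exact:
  bump_poly.
have IB : intg TR (@smooth_bump R 0 1) by apply: intg_supported sB _; exact:
  intg_cc_continuous.
(* The bump has a positive minimum on the middle half of its support. *)
have m0 : 0 < m.
  have [e e0 He] : exists2 e : R, 0 < e & forall x, 1/4 <= x <= 3/4 -> e <=
    smooth_bump 0 1 x.
    have cB' : {within `[(1/4 : R), 3/4], continuous (smooth_bump 0 1)} by exact:
      continuous_subspaceT.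
    have h : (1/4 : R) <= 3/4 by lra.
    have [x xin xmin] := EVT_min h cB'.
    exists (smooth_bump 0 1 x).
      by apply: bump_gt0; move: xin; rewrite in_itv /= => /andP[? ?]; apply/andP;
        split; lra.
    by move=> y yin; apply: xmin; rewrite in_itv.
  apply: (@lt_le_trans _ _ (\int[mu]_(x in `[(1/4 : R), 3/4]) e)).
    by rewrite Rintegral_cst_cc ?mulr_gt0//; lra.
  apply: (@le_trans _ _ (\int[mu]_(x in `[(1/4 : R), 3/4]) smooth_bump 0 1 x)).
    apply: le_Rintegral => //.
    - by apply: intg_cc_continuous; exact: cst_continuous.
    - exact: intg_cc_continuous.
  apply: Rintegral_ge0_sub => // x _.
  by have /andP[] := bump_bound 0 1 x.
pose eta x := m^-1 * smooth_bump 0 1 x.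
pose c := \int[mu]_x (w x * eta x).
have seta : supported eta 0 1 by move=> x nx; rewrite /eta sB// mulr0.
have peta : flat_poly eta.
  by apply: flat_poly_mul; [exact: flat_poly_cst|exact: bump_poly].
have ceta := flat_poly_continuous peta.
have Ieta : \int[mu]_x eta x = 1.
  by rewrite RintegralZl// -/m mulVf// gt_eqF.
exists c; apply: null_of_plateau.
  by move=> a b; apply: intgB => //; apply: intg_cc_continuous; exact: cst_continuous.
move=> a b n ab.
set psi := plateau a b n.
have ppsi : flat_poly psi by exact: plateau_poly.
have cpsi := flat_poly_continuous ppsi.
have spsi : supported psi a b by exact: plateau_supported.
have Ipsi : intg TR psi by apply: intg_supported spsi _; exact: intg_cc_continuous.
pose s := \int[mu]_x psi x.
pose theta x := psi x + (- s) * eta x.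
have ptheta : flat_poly theta.
  by apply: flat_poly_add => //; apply: flat_poly_mul => //; exact: flat_poly_cst.
have ctheta := flat_poly_continuous ptheta.
(* A lies strictly below both supports, so that theta vanishes at A as well: the integral over
   [x, A] includes its endpoint. *)
pose A := Num.min a 0 - 1; pose B := Num.max b 1.
have Aa : A < a
  by rewrite /A; have : Num.min a 0 <= a; [rewrite ge_min lexx|lra].
have A0 : A < 0
  by rewrite /A; have : Num.min a 0 <= 0; [rewrite ge_min lexx orbT|lra].
have bB : b <= B by rewrite le_max lexx.
have B1 : 1 <= B by rewrite le_max lexx orbT.
have AB : A <= B by lra.
have theta0 x : ~ (A < x <= B) -> theta x = 0.
  move=> nx; rewrite /theta spsi ?seta ?mulr0 ?addr0// => /andP[x1 x2]; apply: nx.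
    by rewrite (lt_le_trans A0 x1) (le_trans x2).
  by rewrite (lt_le_trans Aa x1) (le_trans x2).
have stheta : supported theta A B.
  by move=> x nx; apply: theta0 => /andP[x1 x2]; apply: nx; rewrite ltW.
have Ieta' : intg TR eta by apply: intg_supported seta _; exact: intg_cc_continuous.
have Itheta : \int[mu]_x theta x = 0.
  rewrite RintegralD//; last exact: intgZ.
  by rewrite RintegralZl// Ieta mulr1 subrr.
have [Phi pPhi] := @primitive_ex R theta (fun x y => @intg_cc_continuous R x y
  theta ctheta).
(* Since theta has mass zero, this primitive vanishes beyond B as well as before A. *)
pose phi x := Phi x - Phi A.
have dphi x : is_derive x (1 : R) phi (theta x).
  by apply: is_derive_congr (is_derive_sub (primitive_derive pPhi (ctheta x))
    (is_derive_const x (Phi A))) _; rewrite subr0.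
have tphi : test_function phi.
  split.
    case=> [|k] x; first by have [] := dphi x.
    rewrite /derive1n iterSr (is_derive_derive1 dphi).
    exact: flat_poly_smooth.
  apply: (@supported_compact _ _ A B) => x nx; rewrite /phi.
  have [xA|Ax] := ltP x A.
    have [_] := pPhi x A (ltW xA); rewrite (_ : Rintegral _ _ _ = 0).
      by move/eqP; rewrite subr_eq0 => /eqP ->; rewrite subrr.
    rewrite -[RHS](mul0r (A - x)) -Rintegral_cst_cc ?ltW//.
    apply: eq_Rintegral => y; rewrite inE /= in_itv /=.
    by move=> /andP[_ yA]; apply: theta0; rewrite ltNge yA.
  have Bx : B < x by rewrite ltNge; apply/negP => xB; apply: nx; rewrite Ax.
  have [_ ->] := pPhi A x Ax.
  rewrite -Itheta; apply/esym; apply: Rintegral_supported => y ny; apply: stheta =>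
    /andP[y1 y2].
  by apply: ny; rewrite y1 (le_trans y2)// ltW.
have := H phi tphi; rewrite (is_derive_derive1 dphi) => E.
have I1 : intg TR (fun x => w x * psi x) by exact: intg_mul_supported spsi cpsi (Iw
  _ _).
have I2 : intg TR (fun x => w x * eta x) by exact: intg_mul_supported seta ceta (Iw
  _ _).
have E2 : \int[mu]_x (w x * theta x) = \int[mu]_x (w x * psi x) - s * c.
  rewrite /c -RintegralZl// -RintegralB//; last exact: intgZ.
  by apply: eq_Rintegral => x _; rewrite /theta; ring.
rewrite -E E2 mulrC /s -RintegralZl// -RintegralB//; last exact: intgZ.
by apply: eq_Rintegral => x _; ring.
Qed.

(** The difference of f and a primitive G of g has zero weak derivative, hence is a.e. a constant c
    by du Bois-Reymond; F is G + c. *)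
Lemma weak_primitive f g : measurable_fun TR f -> (forall a b, intg `[a, b] f) ->
  (forall a b, intg `[a, b] g) ->
  (forall phi, test_function phi ->
     \int[mu]_x (f x * derive1 phi x) = - \int[mu]_x (g x * phi x)) ->
  exists2 F, primitive F g & {ae mu, forall x, f x = F x}.
Proof.
move=> mf If Ig H.
have [G pG] := primitive_ex Ig.
have cG := primitive_continuous pG.
have IG a b : intg `[a, b] G by exact: intg_cc_continuous.
pose w x := f x - G x.
have Iw a b : intg `[a, b] w by apply: intgB.
have [] := @du_bois_reymond w Iw.
  move=> phi tphi; have [tphi' dphi cphi'] := test_function_derive1 tphi.
  have I1 := intg_mul_test If tphi'; have I2 := intg_mul_test IG tphi'.
  have I3 := intg_mul_test Ig tphi.
  have -> : \int[mu]_x (w x * derive1 phi x) =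
      \int[mu]_x (f x * derive1 phi x) - \int[mu]_x (G x * derive1 phi x).
    by rewrite -RintegralB//; apply: eq_Rintegral => x _; rewrite /w; ring.
  rewrite H// -opprD -RintegralD//.
  have [a [b [ab sphi]]] := compact_supported tphi.2.
  have [a' [b' [ab' sphi']]] := compact_supported tphi'.2.
  pose A := Num.min a a' - 1; pose B := Num.max b b' + 1.
  have Aa : A < a
  by rewrite /A; have : Num.min a a' <= a; [rewrite ge_min lexx|lra].
  have Aa' : A < a'
  by rewrite /A; have : Num.min a a' <= a'; [rewrite ge_min lexx orbT|lra].
  have bB : b < B
  by rewrite /B; have : b <= Num.max b b'; [rewrite le_max lexx|lra].
  have bB' : b' < B
  by rewrite /B; have : b' <= Num.max b b'; [rewrite le_max lexx orbT|lra].
  rewrite (@Rintegral_supported _ _ A B); last first.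
    move=> x nx; rewrite sphi ?sphi' ?mulr0 ?addr0// => /andP[x1 x2]; apply: nx.
      by apply/andP; split; lra.
    by apply/andP; split; lra.
  have AB : A <= B by lra.
  (* Integration by parts, as the chain rule with the identity as outer function. The boundary terms
     vanish because A and B lie strictly outside the support of phi. *)
  have := @primitive_chain R G g phi (derive1 phi) id (fun=> 1) 0 A B pG dphi cphi'
    (fun y => is_derive_var y) _ AB.
  rewrite !sphi ?mul0r ?subr0; last 2 first.
  - by move=> /andP[]; lra.
  - by move=> /andP[]; lra.
  move=> E; apply/eqP; rewrite oppr_eq0; apply/eqP; rewrite [RHS]E.
    by apply: eq_Rintegral => x _; rewrite /=; ring.
  by move=> y z; rewrite subrr normr0 mul0r.
move=> c Hc; exists (fun x => G x + c).
  by move=> a b ab; have [? <-] := pG a b ab; split=> //; ring.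
have mw : measurable_fun TR (fun x => w x - c).
  apply: measurable_funB; last exact: measurable_cst.
  by apply: measurable_funB => //; exact: continuous_measurable_fun.
have := ae0_of_null mw _ Hc.
have Iwc a b : intg `[a, b] (fun x => w x - c).
  by apply: intgB => //; apply: intg_cc_continuous; exact: cst_continuous.
move=> /(_ Iwc); apply: ae_mono.
by move=> x; rewrite /w => h; lra.
Qed.

Lemma weak_derivative_unique j f g h : L2 g -> L2 h ->
  is_weak_derivative j f g -> is_weak_derivative j f h ->
  {ae mu, forall x, g x = h x}.
Proof.
move=> lg lh wg wh.
have Ig a b : intg `[a, b] g by exact: L2_loc.
have Ih a b : intg `[a, b] h by exact: L2_loc.
have mgh : measurable_fun TR (fun x => g x - h x).
  by apply: measurable_funB; exact: L2_meas.
have Igh a b : intg `[a, b] (fun x => g x - h x) by exact: intgB.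
have := ae0_of_null mgh Igh _.
have N a b : a <= b -> \int[mu]_(x in `[a, b]) (g x - h x) = 0.
  apply: null_of_plateau => // {}a {}b n ab.
  have t := @test_function_plateau a b n.
  (* The common sign (-1) ^ j is removed by multiplying with it once more. *)
  have := wg _ t; rewrite wh// => /(congr1 (fun z => (-1) ^+ j * z)).
  rewrite !mulrA -!exprD addnn -signr_odd odd_double !mul1r => E.
  have I1 := intg_mul_test Ig t; have I2 := intg_mul_test Ih t.
  rewrite (_ : \int[mu]_x _ = \int[mu]_x (g x * plateau a b n x) - \int[mu]_x (h x
    * plateau a b n x)).
    by rewrite E subrr.
  by rewrite -RintegralB//; apply: eq_Rintegral => x _; ring.
move=> /(_ N); apply: ae_mono.
by move=> x h0; lra.
Qed.

Lemma weak_derivativeP n j f : sobolev n f -> (j <= n)%N ->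
  L2 (weak_derivative j f) /\ is_weak_derivative j f (weak_derivative j f).
Proof.
move=> [_ H] jn; have [g lg wg] := H j jn.
exact: (@getPex _ [set g | g \in Lfun lebesgue_measure 2%:E /\ is_weak_derivative j
  f g]
  (ex_intro _ g (conj lg wg))).
Qed.

Lemma is_weak_derivative0 f : is_weak_derivative 0 f f.
Proof. by move=> phi _; rewrite expr0 mul1r. Qed.

Lemma weak_derivative_ae n j f g : sobolev n f -> (j <= n)%N -> L2 g ->
  is_weak_derivative j f g -> {ae mu, forall x, weak_derivative j f x = g x}.
Proof.
move=> sf jn lg wg; have [l w] := weak_derivativeP sf jn.
exact: weak_derivative_unique w wg.
Qed.

Lemma test_function_derive1n n phi : test_function phi -> test_function (derive1n n
  phi).
Proof.
move=> t; elim: n => [|n IH]; first by [].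
by rewrite derive1nS; have [] := test_function_derive1 IH.
Qed.

(** Combinations of the form a f - b f' are those from which difference quotients are built. *)
Lemma is_weak_derivativeB j f f' g g' a b : L2 f -> L2 f' -> L2 g -> L2 g' ->
  is_weak_derivative j f g -> is_weak_derivative j f' g' ->
  is_weak_derivative j (fun x => a * f x - b * f' x) (fun x => a * g x - b * g' x).
Proof.
move=> lf lf' lg lg' w w' phi t.
have I h psi : L2 h -> test_function psi -> intg TR (fun x => h x * psi x).
  by move=> lh tpsi; apply: intg_mul_test => // c d; exact: L2_loc.
have K h h' psi : L2 h -> L2 h' -> test_function psi ->
   \int[mu]_x ((a * h x - b * h' x) * psi x) =
    a * \int[mu]_x (h x * psi x) - b * \int[mu]_x (h' x * psi x).
  move=> lh lh' tpsi; rewrite -!RintegralZl//; try exact: I.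
  rewrite -RintegralB//; try by apply: intgZ => //; exact: I.
  by apply: eq_Rintegral => x _; ring.
rewrite !K//; last exact: test_function_derive1n.
by rewrite w// w'//; ring.
Qed.

Lemma sobolevB n f f' a b : sobolev n f -> sobolev n f' ->
  sobolev n (fun x => a * f x - b * f' x).
Proof.
move=> [lf Hf] [lf' Hf']; split; first by apply: L2B; exact: L2Z.
move=> j jn; have [g lg wg] := Hf j jn; have [g' lg' wg'] := Hf' j jn.
exists (fun x => a * g x - b * g' x); first by apply: L2B; exact: L2Z.
exact: is_weak_derivativeB.
Qed.

Lemma weak_derivativeB n j f f' a b : sobolev n f -> sobolev n f' -> (j <= n)%N ->
  {ae mu, forall x, weak_derivative j (fun x => a * f x - b * f' x) x =
    a * weak_derivative j f x - b * weak_derivative j f' x}.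
Proof.
move=> sf sf' jn.
have [l w] := weak_derivativeP sf jn; have [l' w'] := weak_derivativeP sf' jn.
apply: (weak_derivative_ae (sobolevB a b sf sf') jn).
  by apply: L2B; exact: L2Z.
by apply: is_weak_derivativeB => //; [exact: sf.1|exact: sf'.1].
Qed.

(** The relation of order j is tested with phi', the one of order j + 1 with phi. *)
Lemma weak_derivative_step j f g h : is_weak_derivative j f g ->
  is_weak_derivative j.+1 f h ->
  forall phi, test_function phi ->
     \int[mu]_x (g x * derive1 phi x) = - \int[mu]_x (h x * phi x).
Proof.
move=> wg wh phi t; have [t' _ _] := test_function_derive1 t.
have := wh phi t; rewrite /derive1n iterSr -/(derive1n j _) (wg _ t').
move=> /(congr1 (fun z => (-1) ^+ j * z)).
rewrite exprS mulN1r mulNr !mulrN !mulrA -!exprD addnn -signr_odd odd_double !mul1r.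
by [].
Qed.

(** The function f and its first two weak derivatives are each a.e. a primitive of the next weak
    derivative. Replacing the first two densities by continuous representatives makes the
    corresponding primitives C^1, and the continuous f equals its own everywhere. The last one, f2,
    remains a primitive of an L^2 function. *)
Lemma sobolev3_regular f : sobolev 3 f -> continuous f ->
  exists f1 f2, [/\ (forall x, is_derive x (1 : R) f (f1 x)),
    (forall x, is_derive x (1 : R) f1 (f2 x)),
    primitive f2 (weak_derivative 3 f),
    {ae mu, forall x, f1 x = weak_derivative 1 f x} &
    {ae mu, forall x, f2 x = weak_derivative 2 f x}].
Proof.
move=> sf cf.
have [l1 w1] := weak_derivativeP sf (isT : (1 <= 3)%N).
have [l2 w2] := weak_derivativeP sf (isT : (2 <= 3)%N).
have [l3 w3] := weak_derivativeP sf (isT : (3 <= 3)%N).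
have step j f' g : L2 f' -> L2 g -> is_weak_derivative j f f' ->
    is_weak_derivative j.+1 f g ->
    exists2 F, primitive F g & {ae mu, forall x, f' x = F x}.
  move=> lf' lg wf' wg; apply: weak_primitive.
  - exact: L2_meas.
  - by move=> a b; exact: L2_loc.
  - by move=> a b; exact: L2_loc.
  - exact: weak_derivative_step wf' wg.
have [F0 p0 e0] := step 0%N f _ sf.1 l1 (is_weak_derivative0 f) w1.
have [F1 p1 e1] := step 1%N _ _ l1 l2 w1 w2.
have [F2 p2 e2] := step 2%N _ _ l2 l3 w2 w3.
have prim F g g' : primitive F g -> L2 g -> continuous g' -> {ae mu, forall x, g x
  = g' x} -> primitive F g'.
  move=> p lg cg' e a b ab; have [I ->] := p a b ab; split; first exact:
    intg_cc_continuous.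
  apply: ae_eq_Rintegral => //.
  - by apply: measurable_funTS; exact: L2_meas.
  - by apply: measurable_funTS; exact: continuous_measurable_fun.
  - apply: ae_mono e.
    by move=> x ->.
have c1 := primitive_continuous p1; have c2 := primitive_continuous p2.
have c0 := primitive_continuous p0.
have q0 := prim _ _ _ p0 l1 c1 e1; have q1 := prim _ _ _ p1 l2 c2 e2.
have E : f = F0.
  apply/funext => x; apply/eqP; rewrite -subr_eq0; apply/eqP.
  have cd : continuous (fun x => f x - F0 x) by move=> y; apply: cvgB; [exact:
    cf|exact: c0].
  apply: continuous_ae0 cd _ x.
  apply: ae_mono e0.
  by move=> y ->; rewrite subrr.
exists F1, F2; split=> //.
- by move=> x; rewrite E; exact: primitive_derive q0 (c1 x).
- by move=> x; exact: primitive_derive q1 (c2 x).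
- exact: ae_mono e1.
- exact: ae_mono e2.
Qed.

End WeakDerivatives.

(** * Energy estimate *)

Section Energy.
Context {R : realType}.
Implicit Types (f g h e z c : R -> R) (a b x y s t : R).
Local Notation mu := (@lebesgue_measure R).
Local Notation intg D f := (integrable mu D (EFin \o f)).
Local Notation TR := (setT : set (measurableTypeR R)).
Local Notation L2 f := (f \in Lfun mu 2%:E).

Definition pospart (y : R) : R := Num.max 0 y.

Lemma pospart_ge0 y : 0 <= pospart y.
Proof. by rewrite le_max lexx. Qed.

Lemma pospart_ge y : y <= pospart y.
Proof. by rewrite le_max lexx orbT. Qed.

Lemma pospartP y : (0 <= y /\ pospart y = y) \/ (y <= 0 /\ pospart y = 0).
Proof.
have [y0|y0] := leP 0 y; first by left; rewrite /pospart max_r.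
by right; rewrite /pospart max_l ?ltW.
Qed.

Lemma pospart_norm y : `|pospart y| <= `|y|.
Proof. by have [[h ->]|[h ->]] := pospartP y; rewrite ?normr0. Qed.

Lemma pospart_lip y (x : R) : `|pospart y - pospart x| <= `|y - x|.
Proof.
rewrite ler_norml; have := ler_norm (y - x); have := ler_norm (- (y - x)); rewrite
  normrN.
by have [[h ->]|[h ->]] := pospartP y; have [[k ->]|[k ->]] := pospartP x => A B;
  apply/andP; split; lra.
Qed.

(** The function (y^+)^2 is C^1 and its second derivative lies between 0 and 2. The bound is kept
    quantitative because it is later integrated in space. *)
Lemma pospart_sqr_taylor y x :
  `|pospart y ^+ 2 - pospart x ^+ 2 - 2 * pospart x * (y - x)| <= (y - x) ^+ 2.
Proof.
rewrite ler_norml.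
have := sqr_ge0 y; have := sqr_ge0 x => qx qy.
have [[h ->]|[h ->]] := pospartP y; have [[k ->]|[k ->]] := pospartP x.
- have -> : y ^+ 2 - x ^+ 2 - 2 * x * (y - x) = (y - x) ^+ 2 by ring.
  by rewrite lexx andbT; have := sqr_ge0 (y - x); lra.
- by have := mulr_ge0_le0 h k => hk; apply/andP; split; nra.
- by have := mulr_ge0_le0 k h => hk; apply/andP; split; nra.
- by have := sqr_ge0 (y - x) => hk; apply/andP; split; lra.
Qed.

Lemma pospart_sqr_le y : pospart y ^+ 2 <= y ^+ 2.
Proof. by have [[h ->]|[h ->]] := pospartP y => //; rewrite expr0n sqr_ge0. Qed.

Lemma is_derive_quadratic f x (l C : R) :
  (forall y, `|f y - f x - l * (y - x)| <= C * (y - x) ^+ 2) ->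
  is_derive x (1 : R) f l.
Proof.
move=> H; apply: is_derive_quotient; apply/cvgrPdist_le => e e0.
have C0 : 0 < `|C| + 1 by rewrite ltr_wpDl.
near=> h.
have h0 : h != 0 by near: h; exact: nbhs_dnbhs_neq.
have he : `|h| <= e / (`|C| + 1).
  near: h; apply: (@cvgr0_norm_le _ _ _ _ _ id) => //; last by rewrite divr_gt0.
  exact: nbhs_dnbhs.
have -> : l - (f (h + x) - f x) / h = - ((f (h + x) - f x - l * (h + x - x)) / h).
  by field.
rewrite normrN normrM normfV ler_pdivrMr ?normr_gt0//.
apply: le_trans (H _) _; rewrite addrK.
rewrite -[h ^+ 2]real_normK ?num_real// expr2 mulrA ler_wpM2r//.
rewrite ler_pdivlMr// in he; apply: le_trans he; rewrite mulrC ler_wpM2l//.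
by rewrite (le_trans (ler_norm _))// lerDl.
Unshelve. all: by end_near. Qed.

Lemma pospart_sqr_derive x : is_derive x (1 : R) (fun y => pospart y ^+ 2) (2 *
  pospart x).
Proof.
by apply: (@is_derive_quadratic _ _ _ 1) => y; rewrite mul1r; exact:
  pospart_sqr_taylor.
Qed.

Lemma pospart_continuous : continuous pospart.
Proof. by apply: (@lipschitz_continuous _ _ 1) => y z; rewrite mul1r; exact:
  pospart_lip. Qed.

Lemma L2_pospart f : L2 f -> L2 (fun x => pospart (f x)).
Proof.
move=> lf; apply: (L2_le _ lf); last by move=> x; exact: pospart_norm.
apply: (measurableT_comp (f := pospart)); last exact: L2_meas.
by apply: continuous_measurable_fun; exact: pospart_continuous.
Qed.

(** f is a.e. equal to min (f, g), which is everywhere at most g. *)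
Lemma ae_le_Rintegral f g : intg TR f -> intg TR g -> {ae mu, forall x, f x <= g x} ->
  \int[mu]_x f x <= \int[mu]_x g x.
Proof.
move=> If Ig fg.
pose k x := Num.min (f x) (g x).
have mk : measurable_fun TR k by apply: measurable_minr; exact: intg_meas.
have Ik : intg TR k.
  apply: (@intg_le R _ _ (fun x => `|f x| + `|g x|)) => //.
    by apply: intgD => //; exact: intg_norm.
  by move=> x _; rewrite /k; case: (leP (f x) (g x)) => _; rewrite ?lerDl ?lerDr.
rewrite (@ae_eq_Rintegral R _ f k)//; last 2 first.
- exact: intg_meas.
- apply: ae_mono fg.
  by move=> x h _; rewrite /k min_l.
by apply: le_Rintegral => // x _; rewrite /k ge_min lexx orbT.
Qed.

(* Testing the differential inequality with the positive part of [e] and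
   integrating by parts leaves only the derivative of the velocity. *)
Lemma transport_ineq e ex z c (c' : R -> R) (M C : R) :
  primitive e ex -> L2 e -> L2 ex -> L2 z ->
  (forall x, is_derive x (1 : R) c (c' x)) -> continuous c' ->
  (forall x, `|c x| <= M) -> (forall x, `|c' x| <= C) ->
  {ae mu, forall x, z x <= - (c x * ex x)} ->
  2 * inner (fun x => pospart (e x)) z <= C * sqnorm2 (fun x => pospart (e x)).
Proof.
move=> pe le lex lz dc cc' cM cC zle.
have lpe := L2_pospart le.
have h1 (y x : R) : `|2 * pospart y - 2 * pospart x| <= 2 * `|y - x|.
  by rewrite -mulrBr normrM ger0_norm// ler_wpM2l// pospart_lip.
have h2 y : `|pospart y ^+ 2| <= y ^+ 2 by rewrite ger0_norm ?sqr_ge0//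
  pospart_sqr_le.
have h3 y : `|2 * pospart y| <= 2 * `|y|.
  by rewrite normrM ger0_norm// ler_wpM2l// pospart_norm.
have [I1 I2 E] := primitive_whole pe le lex dc cc' cM cC pospart_sqr_derive h1 h2 h3.
rewrite /inner /sqnorm2 -!RintegralZl//; last 2 first.
- exact: L2_mul.
- exact: L2_sqr.
apply: (@le_trans _ _ (\int[mu]_x (-1 * (c x * (2 * pospart (e x) * ex x))))).
  apply: ae_le_Rintegral; first by apply: intgZ => //; exact: L2_mul.
    exact: intgZ.
  apply: ae_mono zle.
  move=> x h; have -> : -1 * (c x * (2 * pospart (e x) * ex x)) =
    2 * (pospart (e x) * - (c x * ex x)) by ring.
  by rewrite ler_wpM2l// ler_wpM2l// pospart_ge0.
have -> : \int[mu]_x (-1 * (c x * (2 * pospart (e x) * ex x))) =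
    -1 * \int[mu]_x (c x * (2 * pospart (e x) * ex x)) by rewrite RintegralZl.
rewrite E mulN1r opprK.
apply: le_Rintegral => //; first by apply: intgZ => //; exact: L2_sqr.
move=> x _; rewrite ler_wpM2r ?sqr_ge0//; exact: le_trans (ler_norm _) (cC x).
Qed.

(** With q the difference quotient of e, the energy quotient is a Taylor term of size at most |s -
    t| sqnorm2 q, plus twice the inner product of (e t)^+ and q; by Cauchy-Schwarz the latter
    converges as q tends to z in L^2. Limits within A become one-sided at the initial time. *)
Lemma energy_quotient (A : set R) (e : R -> R -> R) t z :
  (forall s, A s -> L2 (e s)) -> A t -> L2 z ->
  sqnorm2 (fun x => (s - t)^-1 * (e s x - e t x) - z x) @[s --> within A t^'] -->
    (0 : R) ->
  (sqnorm2 (fun x => pospart (e s x)) - sqnorm2 (fun x => pospart (e t x))) / (s - t)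
    @[s --> within A t^'] --> 2 * inner (fun x => pospart (e t x)) z.
Proof.
move=> le At lz H.
have let_ := le t At.
pose n s := sqnorm2 (fun x => (s - t)^-1 * (e s x - e t x) - z x).
pose K := sqnorm2 (fun x => pospart (e t x)).
have lpos := L2_pospart let_.
have K0 : 0 <= K by exact: sqnorm2_ge0.
have bound s : A s -> s != t ->
  `|(sqnorm2 (fun x => pospart (e s x)) - sqnorm2 (fun x => pospart (e t x))) / (s
    - t)
    - 2 * inner (fun x => pospart (e t x)) z| <= `|s - t| * (2 * n s + 2 * sqnorm2 z)
     + 2 * Num.sqrt (K * n s).
  move=> As st.
  have les := le s As; have lps := L2_pospart les.
  have st0 : s - t != 0 by rewrite subr_eq0.
  pose q x := (s - t)^-1 * (e s x - e t x).
  have lq : L2 q by apply: L2Z; exact: L2B.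
  have lqz : L2 (fun x => q x - z x) by exact: L2B.
  pose r x := pospart (e s x) ^+ 2 - pospart (e t x) ^+ 2 - 2 * pospart (e t x) *
    (e s x - e t x).
  have Ir1 : intg TR (fun x => pospart (e s x) ^+ 2 - pospart (e t x) ^+ 2).
    by apply: intgB => //; exact: L2_sqr.
  have Ir2 : intg TR (fun x => 2 * (s - t) * (pospart (e t x) * q x)).
    by apply: intgZ => //; exact: L2_mul.
  have Er : r = (fun x => pospart (e s x) ^+ 2 - pospart (e t x) ^+ 2 - 2 * (s - t)
    * (pospart (e t x) * q x)).
    by apply/funext => x; rewrite /r /q; field.
  have Irr : intg TR r by rewrite Er; exact: intgB.
  have rle : `|\int[mu]_x r x| <= (s - t) ^+ 2 * sqnorm2 q.
    rewrite -sqnorm2Z//; apply: le_Rintegral_norm => //.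
    - exact: intg_meas.
    - by apply: L2_sqr; exact: L2Z.
    - move=> x _; rewrite /r /q; have -> : (s - t) * ((s - t)^-1 * (e s x - e t x))
        = e s x - e t x by field.
      exact: pospart_sqr_taylor.
  have D : sqnorm2 (fun x => pospart (e s x)) - sqnorm2 (fun x => pospart (e t x)) =
     \int[mu]_x r x + 2 * (s - t) * (inner (fun x => pospart (e t x)) (fun x => q x
       - z x)
       + inner (fun x => pospart (e t x)) z).
    rewrite Er RintegralB// [X in _ = _ - X + _]RintegralZl//; last exact: L2_mul.
    rewrite RintegralB//; [|exact: L2_sqr|exact: L2_sqr].
    rewrite -/(sqnorm2 _) -/(sqnorm2 _) /inner -RintegralD//; [|exact:
      L2_mul|exact: L2_mul].
    have -> : \int[mu]_x (pospart (e t x) * (q x - z x) + pospart (e t x) * z x) =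
      \int[mu]_x (pospart (e t x) * q x) by apply: eq_Rintegral => x _; ring.
    by rewrite /sqnorm2; ring.
  rewrite D.
  have -> : forall I J L : R, (I + 2 * (s - t) * (J + L)) / (s - t) - 2 * L = I /
    (s - t) + 2 * J.
    by move=> I J L; field.
  apply: le_trans (ler_normD _ _) _; apply: lerD.
    rewrite normrM normfV ler_pdivrMr ?normr_gt0//.
    apply: le_trans rle _.
    have -> : `|s - t| * (2 * n s + 2 * sqnorm2 z) * `|s - t| = (s - t) ^+ 2 * (2 *
      n s + 2 * sqnorm2 z).
      by rewrite -[in RHS]real_normK ?num_real//; ring.
    rewrite ler_wpM2l ?sqr_ge0//.
    (* The norm of q is bounded through q - z, the quantity known to be small. *)
    have -> : q = (fun x => (q x - z x) + z x) by apply/funext => x; ring.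
    exact: sqnorm2D_le.
  rewrite normrM ger0_norm// ler_wpM2l//.
  rewrite -sqrtr_sqr ler_wsqrtr//; exact: cauchy_schwarz.
apply/cvgrPdist_le => eps eps0.
have Cv : `|s - t| * (2 * n s + 2 * sqnorm2 z) + 2 * Num.sqrt (K * n s) @[s -->
  within A t^'] --> (0 : R).
  have st : `|s - t| @[s --> within A t^'] --> (0 : R).
    have h : `|s - t| @[s --> t] --> (`|t - t| : R).
      by apply: cvg_norm; apply: cvgB; [exact: cvg_id|exact: cvg_cst].
    rewrite subrr normr0 in h; apply: cvg_trans h; apply: cvg_app.
    by apply: cvg_trans (@nbhs_dnbhs _ t); exact: cvg_within.
  have h1 : `|s - t| * (2 * n s + 2 * sqnorm2 z) @[s --> within A t^'] --> 0 * (2 *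
    0 + 2 * sqnorm2 z).
    apply: cvgM => //; apply: cvgD; last exact: cvg_cst.
    by apply: cvgM => //; exact: cvg_cst.
  have h2 : 2 * Num.sqrt (K * n s) @[s --> within A t^'] --> 2 * Num.sqrt (K * 0).
    apply: cvgM; first exact: cvg_cst.
    apply: (continuous_cvg _ (@sqrt_continuous R _)).
    by apply: cvgM => //; exact: cvg_cst.
  rewrite [X in _ --> X](_ : _ = 0 * (2 * 0 + 2 * sqnorm2 z) + 2 * Num.sqrt (K * 0)).
    exact: cvgD.
  by rewrite mul0r add0r mulr0 sqrtr0 mulr0.
move/cvgr0_norm_le : Cv => /(_ _ eps0) Cv.
have nst : \forall s \near within A t^', s != t.
  by rewrite near_withinE; apply: filterS (nbhs_dnbhs_neq t).
near=> s.
have As : A s by near: s; exact: withinT.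
have st : s != t by near: s.
rewrite distrC; apply: le_trans (bound s As st) (le_trans (ler_norm _) _).
by near: s; exact: Cv.
Unshelve. all: by end_near. Qed.

Lemma quotient_continuous_within (A : set R) f t (l : R) : A t ->
  (f s - f t) / (s - t) @[s --> within A t^'] --> l ->
  f s @[s --> within A (nbhs t)] --> f t.
Proof.
move=> At H.
have st : s - t @[s --> within A t^'] --> (0 : R).
  have h : s - t @[s --> t] --> (t - t : R).
    by apply: cvgB; [exact: cvg_id|exact: cvg_cst].
  rewrite subrr in h; apply: cvg_trans h; apply: cvg_app.
  by apply: cvg_trans (@nbhs_dnbhs _ t); exact: cvg_within.
have CK : (f s - f t) / (s - t) * (s - t) @[s --> within A t^'] --> l * 0 by exact:
  cvgM.
rewrite mulr0 in CK.
apply/cvgrPdist_le => eps eps0; move/cvgr0_norm_le : CK => /(_ _ eps0).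
rewrite !near_withinE near_simpl => {}K.
have {}K : \forall s \near t, s != t -> A s -> `|(f s - f t) / (s - t) * (s - t)|
  <= eps.
  exact: K.
apply: filterS K => s K As.
have [->|sn] := eqVneq s t; first by rewrite subrr normr0 ltW.
have := K sn As; rewrite -mulrA mulVf ?mulr1 ?subr_eq0// distrC.
by [].
Qed.

Lemma quotient_is_derive (A : set R) f t (l : R) : nbhs t A ->
  (f s - f t) / (s - t) @[s --> within A t^'] --> l ->
  is_derive t (1 : R) f l.
Proof.
move=> At H; apply: is_derive_quotient.
apply/cvgrPdist_le => eps eps0.
move/cvgrPdist_le : H => /(_ _ eps0); rewrite near_withinE => K.
have {}K : \forall s \near t, s != t -> `|l - (f s - f t) / (s - t)| <= eps.
  by move: K => /(filterI At); apply: filterS => s [As K] /K; apply.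
have sh : (h + t) @[h --> (0 : R)] --> (0 + t : R).
  by apply: cvgD; [exact: cvg_id|exact: cvg_cst].
rewrite add0r in sh.
have := sh _ K; rewrite /= => {}K.
have {}K : \forall h \near (0 : R), h + t != t -> `|l - (f (h + t) - f t) / (h + t
  - t)| <= eps := K.
rewrite /dnbhs near_withinE; apply: filterS K => h K h0.
have := K _; rewrite addrK; apply.
by rewrite -subr_eq0 addrK.
Qed.

(** The integrating factor exp (- C s) makes the product with E nonincreasing. *)
Lemma gronwall_fwd (E E' : R -> R) (tau C : R) : 0 < tau ->
  (forall s, 0 <= s <= tau -> E r @[r --> within `[0, tau] (nbhs s)] --> E s) ->
  (forall s, 0 < s < tau -> is_derive s (1 : R) E (E' s)) ->
  (forall s, 0 < s < tau -> E' s <= C * E s) ->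
  E 0 = 0 -> E tau <= 0.
Proof.
move=> tau0 cE dE EC E0.
pose F s := E s * expR (- C * s).
have dx s : is_derive s (1 : R) (fun s => expR (- C * s)) (expR (- C * s) * (- C *
  1)).
  exact: is_derive_comp_fun (is_derive_expR _) (is_derive_scale (- C)
    (is_derive_var s)).
have dF s : 0 < s < tau -> is_derive s (1 : R) F (E' s * expR (- C * s) + E s *
  (expR (- C * s) * (- C * 1))).
  by move=> st; exact: is_derive_mul (dE s st) (dx s).
have cx : continuous (fun s => expR (- C * s)) by exact: is_derive_continuous dx.
have cF : {within `[0, tau], continuous F}.
  apply/subspace_continuousP => s st; apply: cvgM.
    by apply: cE; move: st; rewrite /= in_itv.
  by apply: cvg_within_filter; exact: cx.
have := @ler0_derive1_le_cc R F 0 tau _ _ cF tau 0 _ _ _.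
rewrite /F E0 mul0r => H.
have {}H : E tau * expR (- C * tau) <= 0.
  apply: H; rewrite ?in_itv /= ?lexx ?ltW//.
  - by move=> s; rewrite in_itv /= => st; have [] := dF s st.
  - move=> s; rewrite in_itv /= => st; rewrite derive1E.
    have d := dF s st; rewrite derive_val.
    have -> : E' s * expR (- C * s) + E s * (expR (- C * s) * (- C * 1)) = (E' s -
      C * E s) * expR (- C * s) by ring.
    by rewrite mulr_le0_ge0 ?expR_ge0// subr_le0 EC.
by rewrite pmulr_lle0 ?expR_gt0// in H.
Qed.

(** The forward case applied to s -> E (tau - s). *)
Lemma gronwall_bwd (E E' : R -> R) (tau C : R) : 0 < tau ->
  (forall s, 0 <= s <= tau -> E r @[r --> within `[0, tau] (nbhs s)] --> E s) ->
  (forall s, 0 < s < tau -> is_derive s (1 : R) E (E' s)) ->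
  (forall s, 0 < s < tau -> - E' s <= C * E s) ->
  E tau = 0 -> E 0 <= 0.
Proof.
move=> tau0 cE dE EC E0.
have := @gronwall_fwd (fun s => E (tau - s)) (fun s => - E' (tau - s)) tau C tau0.
rewrite subr0 subrr; apply=> //.
- move=> s /andP[s0 st].
  have st' : 0 <= tau - s <= tau by lra.
  have K := cE _ st'.
  have sh : (tau - r) @[r --> s] --> tau - s by apply: cvgB; [exact: cvg_cst|exact:
    cvg_id].
  apply/cvgrPdist_le => eps eps0; move/cvgrPdist_le : K => /(_ _ eps0).
  rewrite !near_withinE => K.
  change (nbhs s (fun r => `[0, tau]%classic r -> `|E (tau - s) - E (tau - r)| <=
    eps)).
  have sK : nbhs s (fun r => `[0, tau]%classic (tau - r) ->
    `|E (tau - s) - E (tau - r)| <= eps) := sh _ K.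
  apply: filterS sK => r h; rewrite /= in_itv /= => /andP[r0 rt].
  by apply: h; rewrite /= in_itv /=; apply/andP; split; lra.
- move=> s st; have st' : 0 < tau - s < tau by lra.
  have dB := is_derive_sub (is_derive_const s tau) (is_derive_var s).
  by apply: is_derive_congr (@is_derive_comp_fun R E (fun r => tau - r) s _ _ (dE _
    st') dB) _; ring.
- by move=> s st; apply: EC; lra.
Qed.

(** The integral of f ^ 2 over every interval vanishes, so the zero function is a primitive of the
    continuous f ^ 2. *)
Lemma continuous_sqnorm2_eq0 f : continuous f -> L2 f -> sqnorm2 f <= 0 -> forall
  x, f x = 0.
Proof.
move=> cf lf f0 x.
have c2 : continuous (fun y => f y ^+ 2).
  rewrite (_ : (fun y => _) = (fun y => f y * f y)); last by apply/funext => y;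
    rewrite expr2.
  by move=> y; apply: cvgM; exact: cf.
have p : primitive (fun=> 0) (fun y => f y ^+ 2).
  move=> a b ab; split; first exact: intg_cc_continuous.
  apply/eqP; rewrite subrr eq_le; apply/andP; split.
    by apply: Rintegral_ge0 => y _; exact: sqr_ge0.
  apply: le_trans f0; apply: Rintegral_ge0_sub => //; first exact: L2_sqr.
  by move=> y _; exact: sqr_ge0.
have d1 := primitive_derive p (c2 x); have d2 := is_derive_const x (0 : R).
have : f x ^+ 2 = 0.
  by rewrite -(@derive_val _ _ _ _ _ _ _ d1) (@derive_val _ _ _ _ _ _ _ d2).
by move/eqP; rewrite sqrf_eq0 => /eqP.
Qed.

End Energy.

(** * Comparison with barriers *)

Section Comparison.
Context {R : realType}.
Implicit Types (f g c : R -> R) (a b x y s t : R).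
Local Notation mu := (@lebesgue_measure R).
Local Notation L2 f := (f \in Lfun mu 2%:E).

Lemma pospart_comp_continuous f : continuous f -> continuous (fun x => pospart (f x)).
Proof.
move=> cf x; apply: (@continuous_comp _ _ _ f pospart); first exact: cf.
exact: pospart_continuous.
Qed.

Lemma L2_supported f a b : continuous f -> supported f a b -> L2 f.
Proof.
move=> cf sf; apply: L2P; first exact: continuous_measurable_fun.
apply: (@intg_supported R _ a b) => [x nx|]; first by rewrite sf// expr0n.
apply: intg_cc_continuous.
rewrite (_ : (fun y => _) = (fun y => f y * f y)); last by apply/funext => y;
  rewrite expr2.
by move=> y; apply: cvgM; exact: cf.
Qed.

Lemma sqnorm2_supported_le f (S B : R) : 0 <= S -> continuous f -> supported f (-
  S) S ->
  (forall x, `|f x| <= B) -> sqnorm2 f <= B ^+ 2 * (2 * S).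
Proof.
move=> S0 cf sf fB; rewrite /sqnorm2 (@Rintegral_supported R _ (- S) S); last first.
  by move=> x nx; rewrite sf// expr0n.
have -> : B ^+ 2 * (2 * S) = \int[mu]_(x in `[(- S)%R, S]) (B ^+ 2).
  by rewrite Rintegral_cst_cc; [ring|lra].
apply: le_Rintegral => //.
- by apply: intg_sub (L2_sqr (L2_supported cf sf)).
- by apply: intg_cc_continuous; exact: cst_continuous.
- move=> x _; rewrite -[f x ^+ 2]real_normK ?num_real// lerXn2r ?nnegrE//.
  exact: le_trans (fB x).
Qed.

Variables (kappa r rho : R).

Definition cone s x := (r + rho * s) ^+ 2 - x ^+ 2.
Definition barrier s x := kappa * pospart (cone s x) ^+ 2.
Definition barrier_t s x := kappa * (2 * pospart (cone s x) * (2 * (r + rho * s) *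
  rho)).
Definition barrier_x s x := kappa * (2 * pospart (cone s x) * (- (2 * x))).

Lemma cone_derive s x : is_derive x (1 : R) (cone s) (- (2 * x)).
Proof.
by apply: is_derive_congr (is_derive_sub (is_derive_const x ((r + rho * s) ^+ 2))
  (sqr_derive x)) _; rewrite sub0r.
Qed.

Lemma barrier_derive s x : is_derive x (1 : R) (barrier s) (barrier_x s x).
Proof.
apply: is_derive_scale; exact: (@is_derive_comp_fun R (fun y => pospart y ^+ 2)
  (cone s) x _ _ (pospart_sqr_derive _) (cone_derive s x)).
Qed.

Lemma pospart_cone_continuous s : continuous (fun x => pospart (cone s x)).
Proof.
by apply: pospart_comp_continuous; exact: is_derive_continuous (cone_derive s).
Qed.

Lemma barrier_continuous s : continuous (barrier s).
Proof. exact: is_derive_continuous (barrier_derive s). Qed.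

Lemma barrier_x_continuous s : continuous (barrier_x s).
Proof.
move=> x; apply: cvgM; first exact: cvg_cst.
apply: cvgM; first by apply: cvgM; [exact: cvg_cst|exact: pospart_cone_continuous].
by apply: cvgN; apply: cvgM; [exact: cvg_cst|exact: cvg_id].
Qed.

Lemma barrier_t_continuous s : continuous (barrier_t s).
Proof.
move=> x; apply: cvgM; first exact: cvg_cst.
apply: cvgM; last exact: cvg_cst.
by apply: cvgM; [exact: cvg_cst|exact: pospart_cone_continuous].
Qed.

Lemma pospart_cone_eq0 s x : `|r + rho * s| <= `|x| -> pospart (cone s x) = 0.
Proof.
move=> h; have : (r + rho * s) ^+ 2 <= x ^+ 2.
  by rewrite -[leLHS]real_normK ?num_real// -[leRHS]real_normK ?num_real// lerXn2r
    ?nnegrE.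
by move=> h'; rewrite /pospart max_l// /cone subr_le0.
Qed.

Lemma pospart_cone_supported s (S : R) : `|r + rho * s| <= S ->
  supported (fun x => pospart (cone s x)) (- S) S.
Proof.
move=> h x nx; apply: pospart_cone_eq0; apply: le_trans h _.
by rewrite leNgt; apply/negP => xS; apply: nx; rewrite -ler_norml ltW.
Qed.

Lemma barrier_L2 s : [/\ L2 (barrier s), L2 (barrier_x s) & L2 (barrier_t s)].
Proof.
have sp := @pospart_cone_supported s _ (lexx _).
split; apply: (@L2_supported _ (- `|r + rho * s|) `|r + rho * s|).
- exact: barrier_continuous.
- by move=> x nx; rewrite /barrier sp// expr0n mulr0.
- exact: barrier_x_continuous.
- by move=> x nx; rewrite /barrier_x sp// mulr0 mul0r mulr0.
- exact: barrier_t_continuous.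
- by move=> x nx; rewrite /barrier_t sp// mulr0 mul0r mulr0.
Qed.

Lemma barrier_quotient (A : set R) t :
  sqnorm2 (fun x => (s - t)^-1 * (barrier s x - barrier t x) - barrier_t t x)
    @[s --> within A t^'] --> (0 : R).
Proof.
(* A bound for the radius at both times s and t as long as |s - t| <= 1. *)
pose S := `|r + rho * t| + `|rho|.
have S0 : 0 <= S by rewrite addr_ge0.
(* K collects the Taylor remainder of the squared positive part and the part of
   [cone s x - cone t x] that is quadratic in s - t; [barrier_t] accounts for the linear part. *)
pose K := `|kappa| * (rho ^+ 2 * (2 * `|r + rho * t| + `|rho|) ^+ 2
   + 2 * (r + rho * t) ^+ 2 * rho ^+ 2).
have bnd s : s != t -> `|s - t| <= 1 ->
    sqnorm2 (fun x => (s - t)^-1 * (barrier s x - barrier t x) - barrier_t t x)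
      <= (K * `|s - t|) ^+ 2 * (2 * S).
  move=> st st1.
  have st0 : s - t != 0 by rewrite subr_eq0.
  have rs : r + rho * s = r + rho * t + rho * (s - t) by ring.
  have rsS : `|r + rho * s| <= S.
    rewrite rs; apply: le_trans (ler_normD _ _) _; rewrite /S lerD2l normrM.
    by rewrite -[leRHS]mulr1 ler_wpM2l.
  have rtS : `|r + rho * t| <= S by rewrite /S lerDl.
  apply: sqnorm2_supported_le => //.
  - move=> x; apply: cvgB; last exact: barrier_t_continuous.
    apply: cvgM; first exact: cvg_cst.
    by apply: cvgB; exact: barrier_continuous.
  - move=> x nx; rewrite /barrier /barrier_t (pospart_cone_supported rsS)//
      (pospart_cone_supported rtS)//.
    by rewrite expr0n /=; ring.
  move=> x.
  set Z := cone s x; set Z0 := cone t x.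
  have EZ : Z - Z0 = (s - t) * (rho * (2 * (r + rho * t) + rho * (s - t))).
    by rewrite /Z /Z0 /cone rs; ring.
  have tay := pospart_sqr_taylor Z Z0.
  have p0 : 0 <= pospart Z0 <= (r + rho * t) ^+ 2.
    rewrite pospart_ge0 /= /pospart ge_max sqr_ge0 /= /Z0 /cone gerBl.
    exact: sqr_ge0.
  have -> : (s - t)^-1 * (barrier s x - barrier t x) - barrier_t t x =
    (s - t)^-1 * (kappa * ((pospart Z ^+ 2 - pospart Z0 ^+ 2 - 2 * pospart Z0 * (Z
      - Z0))
       + 2 * pospart Z0 * (rho ^+ 2 * (s - t) ^+ 2))).
    by rewrite /barrier /barrier_t -/Z -/Z0 EZ; field.
  rewrite normrM normfV mulrC ler_pdivrMr ?normr_gt0//.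
  have -> : K * `|s - t| * `|s - t| = `|kappa| * ((s - t) ^+ 2 * (rho ^+ 2 * (2 *
    `|r + rho * t| + `|rho|) ^+ 2)
     + 2 * (r + rho * t) ^+ 2 * (rho ^+ 2 * (s - t) ^+ 2)).
    by rewrite -[(s - t) ^+ 2]real_normK ?num_real// /K; ring.
  rewrite normrM ler_wpM2l//; apply: le_trans (ler_normD _ _) _; apply: lerD.
    apply: le_trans tay _; rewrite EZ exprMn ler_wpM2l ?sqr_ge0// exprMn ler_wpM2l
      ?sqr_ge0//.
    rewrite -[leLHS]real_normK ?num_real// lerXn2r ?nnegrE ?addr_ge0 ?mulr_ge0//.
    apply: le_trans (ler_normD _ _) _; apply: lerD; rewrite normrM.
      by rewrite (ger0_norm (ler0n R 2)).
    by rewrite -[leRHS]mulr1 ler_wpM2l.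
  case/andP: p0 => p0 p1.
  have q0 : 0 <= rho ^+ 2 * (s - t) ^+ 2 by rewrite mulr_ge0 ?sqr_ge0.
  rewrite ger0_norm; last exact: (mulr_ge0 (mulr_ge0 (ler0n R 2) p0) q0).
  by rewrite ler_wpM2r// ler_wpM2l.
have st : `|s - t| @[s --> within A t^'] --> (0 : R).
  have h : `|s - t| @[s --> t] --> (`|t - t| : R).
    by apply: cvg_norm; apply: cvgB; [exact: cvg_id|exact: cvg_cst].
  rewrite subrr normr0 in h; apply: cvg_trans h; apply: cvg_app.
  by apply: cvg_trans (@nbhs_dnbhs _ t); exact: cvg_within.
have Cv : (K * `|s - t|) ^+ 2 * (2 * S) @[s --> within A t^'] --> (0 : R).
  rewrite [X in _ --> X](_ : _ = (K * 0) * (K * 0) * (2 * S)); last by ring.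
  under eq_fun do rewrite expr2.
  apply: cvgM; last exact: cvg_cst.
  by apply: cvgM; apply: cvgM => //; exact: cvg_cst.
have nst : \forall s \near within A t^', s != t.
  by rewrite near_withinE; apply: filterS (nbhs_dnbhs_neq t).
apply: (squeeze_cvgr _ (cvg_cst 0) Cv).
near=> s; rewrite sqnorm2_ge0 /=; apply: bnd; first by near: s.
by near: s; apply: (cvgr_le _ st); exact: ltr01.
Unshelve. all: by end_near. Qed.

(* [c] is the velocity at time [s], [n] the space derivative of [m s], and [w]
   the time derivative of [m] at [s] in L^2. *)
Definition transported (A : set R) (m : R -> R -> R) (M C : R) s :=
  exists c c' n w, [/\ [/\ L2 n, L2 w & primitive (m s) n],
    [/\ (forall x, is_derive x (1 : R) c (c' x)), continuous c',
        (forall x, `|c x| <= M) & (forall x, `|c' x| <= C)],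
    {ae mu, forall x, w x = - (c x * n x)} &
    sqnorm2 (fun x => (h - s)^-1 * (m h x - m s x) - w x) @[h --> within A s^'] -->
      (0 : R)].

(** For a given velocity the relation is linear in m, so the same c serves - m, even where c was
    built from the solution itself. *)
Lemma transportedN (A : set R) (m : R -> R -> R) (M C : R) s :
  transported A m M C s -> transported A (fun s x => - m s x) M C s.
Proof.
move=> [c [c' [n [w [[ln lw pn] dc ae cv]]]]].
exists c, c', (fun x => - n x), (fun x => - w x); split=> //.
- split; [exact: L2N|exact: L2N|].
  move=> a b ab; have [I E] := pn a b ab; split.
    rewrite (_ : (fun x => - n x) = (fun x => -1 * n x)); first exact: intgZ.
    by apply/funext => x; rewrite mulN1r.
  have -> : - m s b - - m s a = -1 * (m s b - m s a) by ring.
  by rewrite E -RintegralZl//; apply: eq_Rintegral => x _; rewrite mulN1r.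
- by apply: ae_mono ae; move=> x ->; ring.
- apply: cvg_trans cv; apply: near_eq_cvg; apply: nearW => h.
  by rewrite /sqnorm2; apply: eq_Rintegral => x _; ring.
Qed.

Variables (A : set R) (m : R -> R -> R) (tau M C : R).
Hypotheses (tau0 : 0 < tau) (tauA : forall s, 0 <= s <= tau -> A s)
  (nA : forall s, 0 < s < tau -> nbhs s A)
  (lm : forall s, A s -> L2 (m s))
  (Hm : forall s, 0 <= s <= tau -> transported A m M C s)
  (rad : forall s, 0 <= s <= tau -> 0 <= r + rho * s).

Let E s := sqnorm2 (fun x => pospart (barrier s x - m s x)).

(** The number sg is 1 or -1, for estimates forward or backward in time: reversing time changes the
    sign of both the time derivative and the velocity. *)
Let E_quotient s : 0 <= s <= tau -> exists z, [/\
   forall sg : R, sg ^+ 2 = 1 -> sg * (kappa * rho) <= - (`|kappa| * M) ->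
      sg * (2 * inner (fun x => pospart (barrier s x - m s x)) z) <= C * E s &
   (E h - E s) / (h - s) @[h --> within A s^'] --> 2 * inner (fun x => pospart
     (barrier s x - m s x)) z].
Proof.
move=> st; have As := tauA st.
have [c [c' [n [w [[ln lw pn] [dc cc' cM cC] wn cv]]]]] := Hm st.
have [lb lbx lbt] := barrier_L2 s.
pose z x := barrier_t s x - w x.
have lz : L2 z by exact: L2B.
have le h : A h -> L2 (fun x => barrier h x - m h x).
  by move=> Ah; apply: L2B; [have [] := barrier_L2 h|exact: lm].
exists z; split.
- move=> sg sg2 sgk.
  have -> : sg * (2 * inner (fun x => pospart (barrier s x - m s x)) z) =
     2 * inner (fun x => pospart (barrier s x - m s x)) (fun x => sg * z x).
    rewrite mulrCA /inner -RintegralZl//; last by apply: L2_mul => //; apply: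
      L2_pospart; exact: le.
    by congr (_ * _); apply: eq_Rintegral => x _; ring.
  apply: (@transport_ineq R (fun x => barrier s x - m s x) (fun x => barrier_x s x
    - n x)
     (fun x => sg * z x) (fun x => sg * c x) (fun x => sg * c' x) M C).
  + apply: primitiveB => //; apply: C1_primitive; first exact: barrier_derive.
    exact: barrier_x_continuous.
  + exact: le.
  + exact: L2B.
  + exact: L2Z.
  + by move=> x; apply: cvgM; [exact: cvg_cst|exact: cc'].
  + move=> x; rewrite normrM; suff -> : `|sg| = 1 by rewrite mul1r.
    by apply/eqP; rewrite -sqrp_eq1// real_normK ?num_real// sg2.
  + move=> x; rewrite normrM; suff -> : `|sg| = 1 by rewrite mul1r.
    by apply/eqP; rewrite -sqrp_eq1// real_normK ?num_real// sg2.
  apply: ae_mono wn.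
  move=> x wx; rewrite /z wx -subr_ge0.
  (* The terms in n cancel because m solves the equation; what remains is - sg times the transport
     operator applied to the barrier. Inside the cone |x| < r + rho s, hence |c x x| <= M (r + rho
     s). *)
  have -> : - (sg * c x * (barrier_x s x - n x)) - sg * (barrier_t s x - - (c x * n
    x)) =
     4 * pospart (cone s x) * (- (sg * (kappa * rho)) * (r + rho * s) + sg * kappa
       * (c x * x)).
    by rewrite /barrier_x /barrier_t; ring.
  have [xr|xr] := leP `|r + rho * s| `|x|; first by rewrite pospart_cone_eq0//
    mulr0 mul0r.
  rewrite mulr_ge0 ?mulr_ge0 ?pospart_ge0//.
  have r0 := rad st; rewrite (ger0_norm r0) in xr.
  have h1 : `|kappa| * M * (r + rho * s) <= - (sg * (kappa * rho)) * (r + rho * s).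
    by rewrite ler_wpM2r//; lra.
  have sg1 : `|sg| = 1 by apply/eqP; rewrite -sqrp_eq1// real_normK ?num_real// sg2.
  have h2 : `|sg * kappa * (c x * x)| <= `|kappa| * M * (r + rho * s).
    rewrite !normrM sg1 mul1r -mulrA ler_wpM2l// ler_pM//; exact: ltW.
  by have := ler_norm (- (sg * kappa * (c x * x))); rewrite normrN; lra.
- apply: (energy_quotient le As lz).
  have cb := @barrier_quotient A s.
  have cs : 2 * sqnorm2 (fun x => (h - s)^-1 * (barrier h x - barrier s x) -
    barrier_t s x)
     + 2 * sqnorm2 (fun x => (h - s)^-1 * (m h x - m s x) - w x) @[h --> within A
         s^'] --> (0 : R).
    rewrite [X in _ --> X](_ : _ = 2 * 0 + 2 * 0); last by ring.
    by apply: cvgD; (apply: cvgM; [exact: cvg_cst|]).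
  apply: (squeeze_cvgr _ (cvg_cst 0) cs).
  have AA : \forall h \near within A s^', A h by exact: withinT.
  apply: filterS AA => h Ah; rewrite sqnorm2_ge0 /=.
  have [lbh _ _] := barrier_L2 h.
  have l1 : L2 (fun x => (h - s)^-1 * (barrier h x - barrier s x) - barrier_t s x).
    by apply: L2B => //; apply: L2Z; exact: L2B.
  have l2 : L2 (fun x => (h - s)^-1 * (m h x - m s x) - w x).
    by apply: L2B => //; apply: L2Z; apply: L2B; exact: lm.
  have := sqnorm2D_le l1 (L2Z (-1) l2); rewrite (sqnorm2Z (-1) l2) sqrrN expr1n mul1r.
  apply: le_trans; rewrite le_eqVlt; apply/orP; left; apply/eqP; rewrite /sqnorm2.
  by apply: eq_Rintegral => x _; rewrite /z; ring.
Qed.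

Let E_continuous s : 0 <= s <= tau -> E h @[h --> within `[0, tau] (nbhs s)] --> E s.
Proof.
move=> st; have [z [_ cv]] := E_quotient st.
have K := quotient_continuous_within (tauA st) cv.
apply: cvg_trans K; apply: cvg_app => P nP.
have {}nP : nbhs s (fun h => A h -> P h) := nP.
change (nbhs s (fun h => `[0, tau]%classic h -> P h)).
apply: filterS nP => h Ph; rewrite /= in_itv /= => hin.
by apply: Ph; exact: tauA.
Qed.

Let E_derive s : 0 < s < tau -> is_derive s (1 : R) E (derive1 E s) /\
  (forall sg : R, sg ^+ 2 = 1 -> sg * (kappa * rho) <= - (`|kappa| * M) ->
     sg * derive1 E s <= C * E s).
Proof.
move=> st; have st' : 0 <= s <= tau by lra.
have [z [Hz cv]] := E_quotient st'.
have d := quotient_is_derive (nA st) cv.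
have -> : derive1 E s = 2 * inner (fun x => pospart (barrier s x - m s x)) z.
  by rewrite derive1E derive_val.
by split.
Qed.

Let E_eq0 s : (forall x, barrier s x <= m s x) -> E s = 0.
Proof.
move=> H; rewrite /E /sqnorm2 (_ : (fun x => _) = fun=> 0).
  by rewrite /Rintegral integral0.
by apply/funext => x; rewrite /pospart max_l ?expr0n// subr_le0.
Qed.

Let le_of_E s : 0 <= s <= tau -> E s <= 0 -> forall x, barrier s x <= m s x.
Proof.
move=> st Es x.
have [c [c' [n [w [[ln lw pn] _ _ _]]]]] := Hm st.
have cm := primitive_continuous pn.
have l : L2 (fun x => pospart (barrier s x - m s x)).
  by apply: L2_pospart; apply: L2B; [have [] := barrier_L2 s|apply: lm; exact: tauA].
have cp : continuous (fun x => pospart (barrier s x - m s x)).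
  apply: pospart_comp_continuous => y.
  by apply: cvgB; [exact: barrier_continuous|exact: cm].
have := continuous_sqnorm2_eq0 cp l Es x; have := pospart_ge (barrier s x - m s x);
  lra.
Qed.

Lemma comparison_forward : kappa * rho <= - (`|kappa| * M) ->
  (forall x, barrier 0 x <= m 0 x) -> forall x, barrier tau x <= m tau x.
Proof.
move=> kr H0; apply: le_of_E; first by rewrite lexx ltW.
apply: (@gronwall_fwd R E (derive1 E) tau C tau0 E_continuous) => [s st|s st|].
- by have [] := E_derive st.
- have [_ h] := E_derive st; have := h 1; rewrite !mul1r expr1n; exact.
- exact: E_eq0.
Qed.

(** The energy estimate with sg = -1. For kappa < 0 the condition reads rho <= - M: the cone shrinks
    forward in time, hence grows when time is reversed. *)
Lemma comparison_backward : - (kappa * rho) <= - (`|kappa| * M) ->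
  (forall x, barrier tau x <= m tau x) -> forall x, barrier 0 x <= m 0 x.
Proof.
move=> kr H0; apply: le_of_E; first by rewrite lexx ltW.
apply: (@gronwall_bwd R E (derive1 E) tau C tau0 E_continuous) => [s st|s st|].
- by have [] := E_derive st.
- have [_ h] := E_derive st; have := h (-1); rewrite !mulN1r sqrrN expr1n; exact.
- exact: E_eq0.
Qed.

End Comparison.

(** * Consequences of the comparison *)

Section Consequences.
Context {R : realType}.
Implicit Types (f g c : R -> R) (a b x y s t : R).
Local Notation mu := (@lebesgue_measure R).
Local Notation L2 f := (f \in Lfun mu 2%:E).

Lemma nonincreasing_of_derive (F F' : R -> R) : (forall x, is_derive x (1 : R) F
  (F' x)) ->
  (forall x, F' x <= 0) -> forall x y, x <= y -> F y <= F x.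
Proof.
move=> dF F0 x y; rewrite le_eqVlt => /predU1P[->//|xy].
have [//|t _ E] := @MVT R F F' x y xy (fun z _ => dF z).
  by apply: continuous_subspaceT; exact: is_derive_continuous dF.
by rewrite -subr_le0 E mulr_le0_ge0// subr_ge0 ltW.
Qed.

(** The lower bounds tend to 0 as y grows; an explicit y replaces the limit. *)
Lemma ge0_of_exp_decay (K B x0 : R) : (forall y, x0 <= y -> - (B * expR (- y)) <=
  K) -> 0 <= K.
Proof.
move=> H; rewrite leNgt; apply/negP => K0.
have B0 : 0 < B.
  have := H x0 (lexx _); have := expR_gt0 (- x0) => e0 h.
  by rewrite ltNge; apply/negP => B0; have := mulr_le0_ge0 B0 (ltW e0); lra.
(* Chosen so that - K y >= B; with exp y >= 1 + y this yields - K exp y > B. *)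
pose y := `|x0| + B / - K.
have Bk : 0 < B / - K by rewrite divr_gt0// oppr_gt0.
have x0y : x0 <= y by rewrite /y; have := ler_norm x0; lra.
have y0 : 0 <= y by rewrite /y addr_ge0// ltW.
have := H y x0y; rewrite expRN.
have ey := expR_ge1Dx y.
have ey0 := expR_gt0 y.
move=> h; have {}h : - K * expR y <= B.
  by rewrite -ler_pdivlMr//; lra.
have : - K * (1 + y) <= - K * expR y by rewrite ler_wpM2l// oppr_ge0 ltW.
have : B <= - K * y.
  rewrite /y mulrDr mulrCA divff ?mulr1; last by rewrite oppr_eq0 lt_eqF.
  by rewrite lerDr mulr_ge0// oppr_ge0 ltW.
lra.
Qed.

(* [expR (- x) * (f + f')] is nonincreasing and vanishes at +oo; then
   [expR x * f] is nondecreasing and vanishes at -oo. *)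
Lemma helmholtz_sign f f1 f2 (B : R) :
  (forall x, is_derive x (1 : R) f (f1 x)) -> (forall x, is_derive x (1 : R) f1 (f2
    x)) ->
  (forall x, `|f x| <= B) -> (forall x, `|f1 x| <= B) ->
  (forall x, 0 <= f x - f2 x) -> forall x, 0 <= f x + f1 x /\ 0 <= f x.
Proof.
move=> df df1 fB f1B m0.
have dE x : is_derive x (1 : R) (fun x => expR (- x)) (expR (- x) * - 1).
  exact: (@is_derive_comp_fun R expR (fun x => - x) x _ _ (is_derive_expR _)
    (is_derive_opp (is_derive_var x))).
have H x : 0 <= f x + f1 x.
  have mono := @nonincreasing_of_derive _ _ (fun x => is_derive_mul (dE x)
    (is_derive_add (df x) (df1 x))) _.
  have {}mono := mono _; rewrite -(@pmulr_rge0 _ (expR (- x))) ?expR_gt0//.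
  apply: (@ge0_of_exp_decay _ (B + B) x) => y xy.
  apply: le_trans (mono _ x y xy) => [|z]; last first.
    have -> : expR (- z) * -1 * (f z + f1 z) + expR (- z) * (f1 z + f2 z) =
      - (expR (- z) * (f z - f2 z)) by ring.
    by rewrite oppr_le0 mulr_ge0// expR_ge0.
  rewrite mulrC -mulrN ler_wpM2l ?expR_ge0//.
  have := ler_norm (- f y); have := ler_norm (- f1 y); rewrite !normrN.
  by have := fB y; have := f1B y; lra.
move=> x; split=> //.
(* Reflection turns the nondecreasing exp x f x into a nonincreasing function of y = - x, so that
   the same monotonicity and decay lemmas apply. *)
have dE' y : is_derive y (1 : R) (fun y => - (expR (- y) * f (- y)))
     (- (expR (- y) * -1 * f (- y) + expR (- y) * (f1 (- y) * -1))).
  exact: (is_derive_opp (is_derive_mul (dE y) (@is_derive_comp_fun R f (fun x => -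
    x) y _ _ (df _) (is_derive_opp (is_derive_var y))))).
have mono := @nonincreasing_of_derive _ _ (fun y => is_derive_opp (dE' y)) _.
rewrite -(@pmulr_rge0 _ (expR x)) ?expR_gt0//.
apply: (@ge0_of_exp_decay _ B (- x)) => y xy.
have := mono _ (- x) y xy; rewrite !opprK => {}mono.
apply: le_trans (mono _) => [|z]; last first.
  have -> : - - (expR (- z) * -1 * f (- z) + expR (- z) * (f1 (- z) * -1)) =
     - (expR (- z) * (f (- z) + f1 (- z))) by ring.
  by rewrite oppr_le0 mulr_ge0 ?expR_ge0.
rewrite mulrC -mulrN ler_wpM2l ?expR_ge0//.
by have := ler_norm (- f (- y)); rewrite !normrN; have := fB (- y); lra.
Qed.

(** Half of compact support: required of both f and - f, it says that f vanishes for large |x|. *)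
Definition ge0_at_infinity f := exists2 L : R, 0 <= L & forall x, L <= `|x| -> 0 <=
  f x.

Variables (A : set R) (m : R -> R -> R) (tau M C : R).
Hypotheses (tau0 : 0 < tau) (tauA : forall s, 0 <= s <= tau -> A s)
  (nA : forall s, 0 < s < tau -> nbhs s A)
  (lm : forall s, A s -> L2 (m s)) (M0 : 0 <= M)
  (Hm : forall s, 0 <= s <= tau -> transported A m M C s).

Let cm s : 0 <= s <= tau -> continuous (m s).
Proof.
by move=> /Hm[c [c' [n [w [[_ _ pn] _ _ _]]]]]; exact: primitive_continuous pn.
Qed.

Lemma transported_ge0 : (forall x, 0 <= m 0 x) -> forall x, 0 <= m tau x.
Proof.
move=> H x; have := @comparison_forward R 0 0 0 A m tau M C tau0 tauA nA lm Hm.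
have b0 s y : barrier (0 : R) 0 0 s y = 0 by rewrite /barrier mul0r.
have h : forall s, 0 <= s <= tau -> (0 : R) <= 0 + 0 * s by move=> s _; rewrite
  mul0r addr0.
move=> /(_ h); rewrite mul0r normr0 mul0r oppr0 => /(_ (lexx _)) K.
by have := K _ x; rewrite b0; apply=> y; rewrite b0.
Qed.

Lemma transported_gt0 : (forall x, 0 < m 0 x) -> forall x, 0 < m tau x.
Proof.
move=> H x.
(* Shrinking at speed M, the cone still has radius |x| + 1 at time tau. *)
pose r := `|x| + M * tau + 1.
have Mt : 0 <= M * tau by rewrite mulr_ge0// ltW.
have r1 : 1 <= r by rewrite /r; have := normr_ge0 x; lra.
have c0 : {within `[- r, r], continuous (m 0)}.
  by apply: continuous_subspaceT; apply: cm; rewrite lexx ltW.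
have rr : - r <= r by lra.
have [y0 _ Hy0] := EVT_min rr c0.
have d0 := H y0; set d := m 0 y0 in d0 Hy0.
have r40 : 0 < (r ^+ 2) ^+ 2 by rewrite !exprn_gt0//; lra.
(* The initial cone function is at most r ^ 2, so this height keeps the barrier below the minimum d
   of m 0 on [- r, r]. *)
pose k := d / (r ^+ 2) ^+ 2.
have k0 : 0 < k by rewrite divr_gt0.
have := @comparison_forward R k r (- M) A m tau M C tau0 tauA nA lm Hm.
have h : forall s, 0 <= s <= tau -> 0 <= r + - M * s.
  move=> s /andP[s0 st]; have : M * s <= M * tau by rewrite ler_wpM2l.
  by rewrite /r; have := normr_ge0 x; lra.
move=> /(_ h); rewrite (gtr0_norm k0) mulrN => /(_ (lexx _)) K.
have {}K : barrier k r (- M) tau x <= m tau x.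
  apply: K => y; have [yr|yr] := leP `|y| r.
    apply: le_trans (Hy0 y _); last by rewrite in_itv /= -ler_norml.
    rewrite /barrier /k mulrAC ler_pdivrMr// ler_pM2l//.
    rewrite lerXn2r ?nnegrE ?pospart_ge0 ?sqr_ge0//.
    by rewrite /pospart ge_max sqr_ge0 /cone mulr0 addr0 gerBl sqr_ge0.
  rewrite /barrier pospart_cone_eq0 ?expr0n ?mulr0; first exact: ltW.
  by rewrite addr0 ger0_norm; [exact: ltW|lra].
apply: lt_le_trans K; rewrite /barrier mulr_gt0// exprn_gt0// /pospart lt_max /cone.
have -> : r + - M * tau = `|x| + 1 by rewrite /r; ring.
apply/orP; right; rewrite -[x ^+ 2]real_normK ?num_real//.
by have := normr_ge0 x; nra.
Qed.

(** The unit margin makes the cone function at least 1 where |x| < L, so the barrier is at most - K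
    there; elsewhere it is nonpositive while m s is nonnegative. Prescribing the radius only at time
    s lets the lemma serve both directions of time. *)
Let base (L : R) s : 0 <= L -> 0 <= s <= tau -> (forall x, L <= `|x| -> 0 <= m s x) ->
  exists2 K : R, 0 <= K & forall r rho x, (r + rho * s) ^+ 2 = (L + 1) ^+ 2 ->
     barrier (- K) r rho s x <= m s x.
Proof.
move=> L0 st H; have [K K0 HK] := continuous_bounded_cc (- L) L (cm st).
exists K => // r rho x E; rewrite /barrier mulNr.
have Q : 0 <= pospart (cone r rho s x) ^+ 2 by exact: sqr_ge0.
have [xL|xL] := leP L `|x|.
  apply: le_trans (H x xL); rewrite oppr_le0 mulr_ge0//.
have p1 : 1 <= pospart (cone r rho s x).
  apply: le_trans (pospart_ge _); rewrite /cone E -[x ^+ 2]real_normK ?num_real//.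
  by have := normr_ge0 x; nra.
have p2 : 1 <= pospart (cone r rho s x) ^+ 2 by rewrite exprn_ege1.
have := HK x; rewrite -ler_norml (ltW xL) => /(_ isT) mK.
have := ler_norm (- m s x); rewrite normrN.
have : K * 1 <= K * pospart (cone r rho s x) ^+ 2 by rewrite ler_wpM2l.
lra.
Qed.

Lemma transported_support_forward : ge0_at_infinity (m 0) -> ge0_at_infinity (m tau).
Proof.
move=> [L L0 H]; have st : 0 <= (0 : R) <= tau by rewrite lexx ltW.
have [K K0 HK] := base L0 st H.
have Mt : 0 <= M * tau by rewrite mulr_ge0// ltW.
exists (L + 1 + M * tau) => [|x xL]; first lra.
have := @comparison_forward R (- K) (L + 1) M A m tau M C tau0 tauA nA lm Hm.
have h : forall s, 0 <= s <= tau -> 0 <= L + 1 + M * s.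
  by move=> s /andP[s0 st']; rewrite !addr_ge0// mulr_ge0.
move=> /(_ h); rewrite normrN (ger0_norm K0) mulNr => /(_ (lexx _)) Q.
have {}Q := Q (fun y => HK (L + 1) M y _) x.
have := Q _; rewrite /barrier pospart_cone_eq0 ?expr0n ?mulr0; last by rewrite
  ger0_norm//; lra.
by apply; rewrite addr0.
Qed.

Lemma transported_support_backward : ge0_at_infinity (m tau) -> ge0_at_infinity (m 0).
Proof.
move=> [L L0 H]; have st : 0 <= tau <= tau by rewrite lexx ltW.
have [K K0 HK] := base L0 st H.
have Mt : 0 <= M * tau by rewrite mulr_ge0// ltW.
exists (L + 1 + M * tau) => [|x xL]; first lra.
(* The radius is L + 1 at time tau and L + 1 + M tau at time 0. *)
have := @comparison_backward R (- K) (L + 1 + M * tau) (- M) A m tau M C tau0 tauA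
  nA lm Hm.
have h : forall s, 0 <= s <= tau -> 0 <= L + 1 + M * tau + - M * s.
  move=> s /andP[s0 st']; have : M * s <= M * tau by rewrite ler_wpM2l.
  lra.
move=> /(_ h); rewrite normrN (ger0_norm K0) mulrNN => /(_ (lexx _)) Q.
have {}Q := Q (fun y => HK (L + 1 + M * tau) (- M) y _) x.
have := Q _; rewrite /barrier pospart_cone_eq0 ?expr0n ?mulr0; last first.
  by rewrite addr0 ger0_norm//; lra.
by apply; congr (_ ^+ 2); ring.
Qed.

End Consequences.

(** * Sobolev solutions *)

Section Solution.
Context {R : realType}.
Implicit Types (f g c : R -> R) (a b x y s t : R).
Local Notation mu := (@lebesgue_measure R).
Local Notation TR := (setT : set (measurableTypeR R)).
Local Notation L2 f := (f \in Lfun mu 2%:E).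
Local Notation wd := weak_derivative.

Lemma L2_ae f g : measurable_fun TR f -> L2 g -> {ae mu, forall x, f x = g x} -> L2 f.
Proof.
move=> mf lg fg; apply: L2P => //.
have /integrableP[mg2 Ig2] := L2_sqr lg.
apply/integrableP; split; first by apply/measurable_EFinP; exact: measurable_funX.
apply: le_lt_trans Ig2; rewrite le_eqVlt; apply/orP; left; apply/eqP.
apply: ae_eq_integral => //.
- apply: measurableT_comp => //; apply/measurable_EFinP; exact: measurable_funX.
- exact: measurableT_comp.
apply: ae_mono fg.
by move=> x /= -> _.
Qed.

Lemma primitive_ae f g g' : primitive f g -> measurable_fun TR g ->
  L2 g' -> {ae mu, forall x, g x = g' x} -> primitive f g'.
Proof.
move=> p mg lg' e a b ab; have [I ->] := p a b ab; split; first exact: L2_loc.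
apply: ae_eq_Rintegral => //.
- exact: intg_meas.
- by apply: measurable_funTS; exact: L2_meas.
- apply: ae_mono e.
  by move=> x ->.
Qed.

Lemma sobolev_norm_ge0 n f : 0 <= sobolev_norm n f.
Proof. exact: sqrtr_ge0. Qed.

Lemma sqnorm2_weak_derivative_le n j f : (j <= n)%N -> sqnorm2 (wd j f) <=
  sobolev_norm n f ^+ 2.
Proof.
move=> jn; rewrite /sobolev_norm sqr_sqrtr; last first.
  by apply: sumr_ge0 => i _; exact: sqnorm2_ge0.
rewrite (bigD1 (Ordinal (jn : (j < n.+1)%N)))//= lerDl.
by apply: sumr_ge0 => i _; exact: sqnorm2_ge0.
Qed.

Lemma sobolev_le n k f : (k <= n)%N -> sobolev n f -> sobolev k f.
Proof.
by move=> kn [lf H]; split=> // j jk; apply: H; exact: leq_trans kn.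
Qed.

(** Pointwise derivatives are tied to the chosen weak ones because the momentum is defined by the
    former, the Sobolev norm and the equation by the latter. *)
Record classical_derivatives f f1 f2 : Prop := ClassicalDerivatives {
  cd_derive1 : forall x, is_derive x (1 : R) f (f1 x);
  cd_derive2 : forall x, is_derive x (1 : R) f1 (f2 x);
  cd_primitive : primitive f2 (wd 3 f);
  cd_ae1 : {ae mu, forall x, f1 x = wd 1 f x};
  cd_ae2 : {ae mu, forall x, f2 x = wd 2 f x};
  cd_L2_1 : L2 f1;
  cd_L2_2 : L2 f2;
  cd_primitive0 : primitive f (wd 1 f);
  cd_primitive1 : primitive f1 (wd 2 f) }.

Lemma sobolev3_classical f : sobolev 3 f -> continuous f ->
  classical_derivatives f (derive1 f) (derive1n 2 f).
Proof.
move=> sf cf; have [f1 [f2 [d1 d2 p e1 e2]]] := sobolev3_regular sf cf.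
have -> : derive1n 2 f = f2.
  by rewrite derive1nS derive1n1 (is_derive_derive1 d1) (is_derive_derive1 d2).
rewrite (is_derive_derive1 d1).
have [l1 _] := weak_derivativeP sf (isT : (1 <= 3)%N).
have [l2 _] := weak_derivativeP sf (isT : (2 <= 3)%N).
have c1 := is_derive_continuous d2.
have c2 := primitive_continuous p.
have m1 : measurable_fun TR f1 by exact: continuous_measurable_fun.
have m2 : measurable_fun TR f2 by exact: continuous_measurable_fun.
split=> //.
- exact: L2_ae e1.
- exact: L2_ae e2.
- exact: primitive_ae (C1_primitive d1 c1) m1 l1 e1.
- exact: primitive_ae (C1_primitive d2 c2) m2 l2 e2.
Qed.

Lemma sobolev3_sup f : sobolev 3 f -> continuous f -> forall x,
  `|f x| <= 2 * sobolev_norm 3 f /\ `|derive1 f x| <= 2 * sobolev_norm 3 f.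
Proof.
move=> sf cf x; have cd := sobolev3_classical sf cf.
have [l0 w0] := weak_derivativeP sf (isT : (0 <= 3)%N).
have [l1 _] := weak_derivativeP sf (isT : (1 <= 3)%N).
have [l2 _] := weak_derivativeP sf (isT : (2 <= 3)%N).
have e0 := weak_derivative_ae sf (isT : (0 <= 3)%N) sf.1 (is_weak_derivative0 f).
have n0 := sqnorm2_weak_derivative_le f (isT : (0 <= 3)%N).
have n1 := sqnorm2_weak_derivative_le f (isT : (1 <= 3)%N).
have n2 := sqnorm2_weak_derivative_le f (isT : (2 <= 3)%N).
rewrite (ae_eq_sqnorm2 l0 sf.1 e0) in n0.
have N0 := sobolev_norm_ge0 3 f.
(* [primitive_sup] bounds the square by (2 + 1) times the squared norm, and 3 <= 2 ^ 2. *)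
have sq (y : R) : y ^+ 2 <= 3 * sobolev_norm 3 f ^+ 2 -> `|y| <= 2 * sobolev_norm 3 f.
  move=> h; rewrite -(@ler_pXn2r _ 2)// ?nnegrE ?mulr_ge0// real_normK ?num_real//.
  by rewrite exprMn; have := sqr_ge0 (sobolev_norm 3 f); lra.
split; apply: sq.
  by apply: le_trans (primitive_sup x (cd_primitive0 cd) sf.1 l1) _; lra.
have := ae_eq_sqnorm2 (cd_L2_1 cd) l1 (cd_ae1 cd).
by have := primitive_sup x (cd_primitive1 cd) (cd_L2_1 cd) l2; lra.
Qed.

Lemma momentum_primitive f : sobolev 3 f -> continuous f ->
  primitive (momentum f) (fun x => wd 1 f x - wd 3 f x) /\ L2 (momentum f).
Proof.
move=> sf cf; have cd := sobolev3_classical sf cf; split.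
  exact: primitiveB (cd_primitive0 cd) (cd_primitive cd).
by apply: L2B; [exact: sf.1|exact: cd_L2_2 cd].
Qed.

(** With delta the function inside the Sobolev norm, the function on the left is a.e. delta minus
    its second weak derivative; the bound (a - b)^2 <= 2 a^2 + 2 b^2 then gives the factor 4. *)
Lemma momentum_quotient f g v (h : R) : sobolev 3 f -> continuous f ->
  sobolev 3 g -> continuous g -> sobolev 2 v ->
  sqnorm2 (fun x => h * (momentum f x - momentum g x) - (v x - wd 2 v x))
    <= 4 * sobolev_norm 2 (fun x => h * (f x - g x) - v x) ^+ 2.
Proof.
move=> sf cf sg cg sv.
(* The factors 1 put both differences in the form treated by [sobolevB]. *)
pose D x := 1 * f x - 1 * g x.
pose delta x := h * D x - 1 * v x.
have sD : sobolev 2 D by apply: sobolevB; exact: (@sobolev_le 3).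
have sd : sobolev 2 delta by exact: sobolevB.
have -> : (fun x => h * (f x - g x) - v x) = delta.
  by apply/funext => x; rewrite /delta /D !mul1r.
have [l0 _] := weak_derivativeP sd (isT : (0 <= 2)%N).
have [l2 _] := weak_derivativeP sd (isT : (2 <= 2)%N).
have e0 := weak_derivative_ae sd (isT : (0 <= 2)%N) sd.1 (is_weak_derivative0 delta).
have eD := @weak_derivativeB R 2 2 f g 1 1 (@sobolev_le 3 2 _ isT sf) (@sobolev_le
  3 2 _ isT sg) isT.
have ed := @weak_derivativeB R 2 2 D v h 1 sD sv isT.
have [_ lmf] := momentum_primitive sf cf; have [_ lmg] := momentum_primitive sg cg.
have [lv2 _] := weak_derivativeP sv (isT : (2 <= 2)%N).
have e2f := cd_ae2 (sobolev3_classical sf cf).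
have e2g := cd_ae2 (sobolev3_classical sg cg).
rewrite (@ae_eq_sqnorm2 R _ (fun x => wd 0 delta x + (-1) * wd 2 delta x)); last 3
  first.
- exact: (L2B (L2Z h (L2B lmf lmg)) (L2B sv.1 lv2)).
- exact: (L2D l0 (L2Z (-1) l2)).
- move: e0 eD ed e2f e2g => /[swap] eD e0.
  pose FF := ae_filter_ringOfSetsType mu.
  move=> ed e2f e2g.
  have := @filterI _ _ FF _ _ e0 (@filterI _ _ FF _ _ eD (@filterI _ _ FF _ _ ed
    (@filterI _ _ FF _ _ e2f e2g))).
  apply: filterS => x [-> [E1 [-> [E2 E3]]]].
  rewrite -/D in E1; rewrite E1 /momentum E2 E3 /delta /D.
  by move: (wd 2 f x) (wd 2 g x) (wd 2 v x) (f x) (g x) (v x) => a b c p q r; ring.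
apply: le_trans (sqnorm2D_le l0 (L2Z (-1) l2)) _.
rewrite sqnorm2Z// sqrrN expr1n mul1r.
have := sqnorm2_weak_derivative_le delta (isT : (0 <= 2)%N).
have := sqnorm2_weak_derivative_le delta (isT : (2 <= 2)%N).
lra.
Qed.

Variables (k : nat) (u0 : R -> R) (T : \bar R) (u : R -> R -> R).
Hypothesis sol : solution_on k u0 T u.

Let su t : time_interval T t -> sobolev 3 (u t).
Proof. by case: sol => -[H _] _ _ _ /H. Qed.

Let cu t : time_interval T t -> continuous (u t).
Proof. by case: sol => _ H _ _ /H. Qed.

Lemma time_interval_sub tau s : time_interval T tau -> 0 <= s <= tau ->
  time_interval T s.
Proof.
move=> [_ h] /andP[s0 st]; split=> //; apply: le_lt_trans h.
by rewrite lee_fin.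
Qed.

Lemma time_interval_nbhs tau s : time_interval T tau -> 0 < s < tau ->
  nbhs s (time_interval T).
Proof.
move=> h /andP[s0 st].
apply: filterS (nbhs_itvoo s0 st) => y; rewrite /= in_itv /= => /andP[y0 yt].
by apply: (time_interval_sub h); rewrite !ltW.
Qed.

(** Continuity in H^3 and the Sobolev embedding give a bound near each time; compactness of [0, tau]
    makes it uniform. *)
Lemma solution_bounded tau : time_interval T tau -> exists B : R, 0 <= B /\
  forall s, 0 <= s <= tau -> forall x, `|u s x| <= B /\ `|derive1 (u s) x| <= B.
Proof.
move=> Ttau.
pose P (B s : R) := `[0, tau]%classic s -> forall x, `|u s x| <= B /\ `|derive1 (u
  s) x| <= B.
have /compact_near_coveringP/(_ _ (pinfty_nbhs R) P) := @segment_compact R 0 tau.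
have aux (p q N1 N2 : R) : `|p - q| <= 2 * N1 -> N1 <= 1 -> `|q| <= 2 * N2 ->
    `|p| <= 2 * N2 + 2.
  move=> h1 h2 h3; have -> : p = q + (p - q) by ring.
  by apply: le_trans (ler_normD _ _) _; lra.
have loc s : `[0, tau]%classic s -> \forall s' \near s & B \near +oo, P B s'.
  rewrite /= in_itv /= => st.
  have Ts := time_interval_sub Ttau st.
  case: sol => -[_ cvn] _ _ _.
  have /cvgr0_norm_le/(_ _ ltr01) := cvn s Ts.
  rewrite near_withinE => near1.
  (* The embedding constant 2 applied to u s and to u s' - u s, whose norm is at most 1 for s' near
     s. *)
  pose B0 := 2 * sobolev_norm 3 (u s) + 2.
  exists ((fun s' => time_interval T s' -> `|sobolev_norm 3 (u s' \- u s)| <= 1),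
    [set B | B0 <= B]).
    split=> //; exists B0; split; first exact: num_real.
    by move=> y /ltW.
  move=> [s' B] /= [h1 hB]; rewrite /P /= in_itv /= => st' x.
  have Ts' := time_interval_sub Ttau st'.
  have {h1} := h1 Ts'; rewrite ger0_norm ?sobolev_norm_ge0// => h1.
  have Es : (u s' \- u s) = (fun x => 1 * u s' x - 1 * u s x).
    by apply/funext => y; rewrite !mul1r.
  have sd : sobolev 3 (u s' \- u s) by rewrite Es; apply: sobolevB; exact: su.
  have cd : continuous (u s' \- u s) by move=> y; apply: cvgB; exact: cu.
  have [a1 a2] := sobolev3_sup sd cd x.
  have [b1 b2] := sobolev3_sup (su Ts) (@cu s Ts) x.
  have E1 : derive1 (u s' \- u s) x = derive1 (u s') x - derive1 (u s) x.
    have d1 := cd_derive1 (sobolev3_classical (su Ts') (@cu s' Ts')).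
    have d2 := cd_derive1 (sobolev3_classical (su Ts) (@cu s Ts)).
    by rewrite (is_derive_derive1 (fun y => is_derive_sub (d1 y) (d2 y))).
  rewrite E1 in a2.
  split; apply: le_trans hB; rewrite /B0.
    exact: (aux _ _ _ _ a1 h1 b1).
  exact: (aux _ _ _ _ a2 h1 b2).
move=> /(_ _ loc) [B1 [_ HB]].
exists (`|B1| + 1); split; first by rewrite addr_ge0.
have BB : B1 < `|B1| + 1 by rewrite (le_lt_trans (ler_norm B1))// ltrDl.
move=> s st; have sI : `[0, tau]%classic s by rewrite /= in_itv.
exact: (HB _ BB s sI sI).
Qed.

Lemma solution_transported tau : time_interval T tau -> exists M C : R, 0 <= M /\
  forall s, 0 <= s <= tau ->
    transported (time_interval T) (fun t => momentum (u t)) M C s.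
Proof.
move=> Ttau; have [B [B0 HB]] := solution_bounded Ttau.
exists (B ^+ k), (k%:R * B ^+ k.-1 * B); split; first exact: exprn_ge0.
move=> s st; have Ts := time_interval_sub Ttau st.
case: sol => _ _ _ [v [[sv _] dv eqn]].
have sus := su Ts; have cus := @cu s Ts.
have cd := sobolev3_classical sus cus.
have [pm lm] := momentum_primitive sus cus.
have [l1 _] := weak_derivativeP sus (isT : (1 <= 3)%N).
have [l3 _] := weak_derivativeP sus (isT : (3 <= 3)%N).
have [lv2 _] := weak_derivativeP (sv s Ts) (isT : (2 <= 2)%N).
have cX n : continuous (fun x => u s x ^+ n).
  exact: is_derive_continuous (fun x => is_derive_pow n (cd_derive1 cd x)).
(* The a.e. equation is m_t = - u^k m_x once m_t and m_x are read as combinations of weak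
   derivatives of v and u. *)
exists (fun x => u s x ^+ k), (fun x => k%:R * u s x ^+ k.-1 * derive1 (u s) x),
  (fun x => wd 1 (u s) x - wd 3 (u s) x), (fun x => v s x - wd 2 (v s) x).
split.
- split=> //; first exact: L2B.
  by apply: L2B => //; exact: (sv s Ts).1.
- split.
  + by move=> x; exact: is_derive_pow (cd_derive1 cd x).
  + move=> x; apply: cvgM; first by apply: cvgM; [exact: cvg_cst|exact: cX].
    exact: (is_derive_continuous (cd_derive2 cd)).
  + move=> x; rewrite normrX lerXn2r ?nnegrE//; by have [] := HB s st x.
  + move=> x; have [h1 h2] := HB s st x.
    rewrite normrM ler_pM// normrM ger0_norm// ler_wpM2l// normrX lerXn2r ?nnegrE//.
- apply: ae_mono (eqn s Ts).
  by move=> x h; apply/eqP; rewrite -subr_eq0; apply/eqP; rewrite -[RHS]h; ring.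
- have dvs := dv s Ts.
  have c4 : 4 * (sobolev_norm 2 (fun x => (h - s)^-1 * (u h x - u s x) - v s x) *
      sobolev_norm 2 (fun x => (h - s)^-1 * (u h x - u s x) - v s x))
      @[h --> within (time_interval T) s^'] --> (0 : R).
    rewrite [X in _ --> X](_ : _ = 4 * (0 * 0)); last by ring.
    by apply: cvgM; [exact: cvg_cst|exact: cvgM].
  apply: (squeeze_cvgr _ (cvg_cst 0) c4).
  have AA : \forall h \near within (time_interval T) s^', time_interval T h by
    exact: withinT.
  apply: filterS AA => h Th; rewrite sqnorm2_ge0 /= -expr2.
  exact: (@momentum_quotient (u h) (u s) (v s) (h - s)^-1 (su Th) (@cu h Th) sus
    cus (sv s Ts)).
Qed.

Lemma solution_momentum_L2 s : time_interval T s -> L2 (momentum (u s)).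
Proof. by move=> Ts; have [] := momentum_primitive (su Ts) (@cu s Ts). Qed.

Lemma solution_helmholtz t : time_interval T t ->
  ((forall x, 0 <= momentum (u t) x) -> forall x, 0 <= u t x + derive1 (u t) x /\ 0
    <= u t x) /\
  ((forall x, momentum (u t) x <= 0) -> forall x, u t x + derive1 (u t) x <= 0 /\ u
    t x <= 0).
Proof.
move=> Tt; have cd := sobolev3_classical (su Tt) (@cu t Tt).
have Tt' : 0 <= t <= t by rewrite lexx (proj1 Tt).
have [B [B0 HB]] := solution_bounded Tt.
have [d1 d2] := (cd_derive1 cd, cd_derive2 cd).
split=> m0 x.
  apply: (helmholtz_sign d1 d2 (B := B)) => // y; by have [] := HB t Tt' y.
have := @helmholtz_sign R (fun y => - u t y) (fun y => - derive1 (u t) y) (fun y =>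
  - derive1n 2 (u t) y) B
  (fun y => is_derive_opp (d1 y)) (fun y => is_derive_opp (d2 y)).
have H1 y : `|- u t y| <= B by rewrite normrN; have [] := HB t Tt' y.
have H2 y : `|- derive1 (u t) y| <= B by rewrite normrN; have [] := HB t Tt' y.
have H3 y : 0 <= - u t y - - derive1n 2 (u t) y by have := m0 y; rewrite /momentum;
  lra.
by move=> /(_ H1 H2 H3 x)[h1 h2]; split; lra.
Qed.

End Solution.

(** * Propagation of sign and support *)

Section Propagation.
Context {R : realType}.
Implicit Types (f : R -> R) (x s t : R).
Local Notation mu := (@lebesgue_measure R).
Local Notation L2 f := (f \in Lfun mu 2%:E).

Lemma compactly_supportedP f : compactly_supported f <->
  ge0_at_infinity f /\ ge0_at_infinity (fun x => - f x).
Proof.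
split=> [/compact_supported[a [b [ab sf]]]|[[L L0 HL] [L' L'0 HL']]].
  have f0 x : `|a| + `|b| + 1 <= `|x| -> f x = 0.
    move=> h; apply: sf => /andP[ax xb].
    have := ler_norm b; have := ler_norm (- a); rewrite normrN => a1 b1.
    have a0 := normr_ge0 a; have b0 := normr_ge0 b.
    have : `|x| <= `|a| + `|b| by rewrite ler_norml; apply/andP; split; lra.
    lra.
  by split; exists (`|a| + `|b| + 1); rewrite ?addr_ge0// => x /f0 ->; rewrite ?oppr0.
apply: (@supported_compact _ _ (- (L + L')) (L + L')) => x nx.
have Lx : L + L' < `|x| by rewrite ltNge; apply/negP => h; apply: nx; rewrite
  -ler_norml.
by have := HL x; have := HL' x; move=> h' h; apply/eqP; rewrite eq_le;
  rewrite -oppr_ge0 h' ?h//; lra.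
Qed.

Lemma propagation (T : \bar R) (m : R -> R -> R) :
  (forall s, time_interval T s -> L2 (m s)) ->
  (forall tau, time_interval T tau -> exists M C : R, 0 <= M /\
     forall s, 0 <= s <= tau -> transported (time_interval T) m M C s) ->
  forall t, time_interval T t ->
  [/\ ((forall x, 0 <= m 0 x) -> forall x, 0 <= m t x),
      ((forall x, 0 < m 0 x) -> forall x, 0 < m t x) &
      (ge0_at_infinity (m 0) <-> ge0_at_infinity (m t))].
Proof.
move=> lm Hm t Tt; have [M [C [M0 HM]]] := Hm t Tt.
(* At t = 0 all three claims are immediate; the comparison requires a positive time. *)
have [t0 _] := Tt; move: t0; rewrite le_eqVlt => /predU1P[<-//|t0].
have tA s : 0 <= s <= t -> time_interval T s by exact: time_interval_sub Tt.
have nA s : 0 < s < t -> nbhs s (time_interval T) by exact: time_interval_nbhs Tt.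
split.
- exact: transported_ge0 t0 tA nA lm HM.
- exact: transported_gt0 t0 tA nA lm M0 HM.
split; first exact: transported_support_forward t0 tA nA lm M0 HM.
exact: transported_support_backward t0 tA nA lm M0 HM.
Qed.

End Propagation.

Theorem theorem2p1 (R : realType) (k : nat) (u0 : R -> R) (T : \bar R)
    (u : R -> R -> R)
    (hk : (0 < k)%N)
    (hu0 : sobolev 3 u0) (hu0c : continuous u0)
    (hu : solution_with_lifespan k u0 T u) :
  let m0 : R -> R := momentum u0 in
  let m : R -> R -> R := fun t => momentum (u t) in
  (* 1 *)
  ((does_not_change_sign setT m0 ->
      does_not_change_sign (time_interval T `*` setT) (fun p => m p.1 p.2)) /\
   ((forall x, 0 <= m0 x) ->
      forall t x, time_interval T t -> 0 <= m t x) /\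
   ((forall x, m0 x <= 0) ->
      forall t x, time_interval T t -> m t x <= 0) /\
   (forall c : R, (forall x, Num.sg (m0 x) = c) ->
      forall t x, time_interval T t -> Num.sg (m t x) = c)) /\
  (* 2 *)
  (forall t, time_interval T t ->
     (compactly_supported (m t) <-> compactly_supported m0)) /\
  (* 3 *)
  (((forall x, 0 <= m0 x) ->
      forall t x, time_interval T t -> 0 <= u t x) /\
   ((forall x, m0 x <= 0) ->
      forall t x, time_interval T t -> u t x <= 0)) /\
  (* 4 *)
  (((forall x, 0 <= m0 x) ->
      forall t x, time_interval T t -> 0 <= u t x + derive1 (u t) x) /\
   ((forall x, m0 x <= 0) ->
      forall t x, time_interval T t -> u t x + derive1 (u t) x <= 0)).
Proof.
move=> m0 m; case: hu => T0 sol _.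
have m00 : m 0 = m0 by rewrite /m; case: sol => _ _ -> _.
have lm s : time_interval T s -> m s \in Lfun lebesgue_measure 2%:E.
  by move=> Ts; exact: (solution_momentum_L2 sol Ts).
have tr : forall tau, time_interval T tau -> exists M C : R, 0 <= M /\
    forall s, 0 <= s <= tau -> transported (time_interval T) m M C s.
  exact: solution_transported sol.
have hz : forall t, time_interval T t ->
    ((forall x, 0 <= m t x) -> forall x, 0 <= u t x + derive1 (u t) x /\ 0 <= u t
      x) /\
    ((forall x, m t x <= 0) -> forall x, u t x + derive1 (u t) x <= 0 /\ u t x <= 0).
  by move=> t Tt; exact: (solution_helmholtz sol Tt).
clearbody m0 m.
(* The opposite momentum supplies the statements with reversed sign; its body stays behind an
   equation so that it does not unfold. *)
have [nm nmE] : exists nm : R -> R -> R, nm = fun t x => - m t x by eexists.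
have nmx t x : nm t x = - m t x by rewrite nmE.
have lnm s : time_interval T s -> nm s \in Lfun lebesgue_measure 2%:E.
  by move=> Ts; rewrite nmE; exact: L2N (lm s Ts).
have ntr tau : time_interval T tau -> exists M C : R, 0 <= M /\
    forall s, 0 <= s <= tau -> transported (time_interval T) nm M C s.
  move=> Ttau; have [M [C [M0 H]]] := tr tau Ttau; exists M, C; split; first exact:
    M0.
  by move=> s st; rewrite nmE; exact: transportedN (H s st).
have nm_at t : (fun x => - m t x) = nm t by apply/funext => x; rewrite nmx.
have pr t Tt := propagation lm tr (t := t) Tt.
have npr t Tt := propagation lnm ntr (t := t) Tt.
clear lm tr lnm ntr sol nmE.
have ge t : time_interval T t -> (forall x, 0 <= m0 x) -> forall x, 0 <= m t x.
  by move=> Tt h; have [H _ _] := pr t Tt; apply: H; rewrite m00.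
have le t : time_interval T t -> (forall x, m0 x <= 0) -> forall x, m t x <= 0.
  move=> Tt h x; have [H _ _] := npr t Tt.
  by rewrite -oppr_ge0 -nmx; apply: H => y; rewrite nmx oppr_ge0 m00.
have gt t : time_interval T t -> (forall x, 0 < m0 x) -> forall x, 0 < m t x.
  by move=> Tt h; have [_ H _] := pr t Tt; apply: H; rewrite m00.
have lt t : time_interval T t -> (forall x, m0 x < 0) -> forall x, m t x < 0.
  move=> Tt h x; have [_ H _] := npr t Tt.
  by rewrite -oppr_gt0 -nmx; apply: H => y; rewrite nmx oppr_gt0 m00.
split; [split; [|split; [|split]]|split; [|split; split]].
- by case=> h; [left|right] => -[t x] [Tt _]; [exact: (ge t Tt (fun y => h y
    I))|exact: (le t Tt (fun y => h y I))].
- by move=> h t x Tt; exact: (ge t Tt h).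
- by move=> h t x Tt; exact: (le t Tt h).
(* The constant c is the sign of m0 at 0. If it is 0, then m0 vanishes and the two weak sign
   statements together give m = 0. *)
- move=> c h t x Tt; have := h 0; case: (sgrP (m0 0)) => s0 cE.
  + have z y : m0 y = 0 by apply/eqP; rewrite -sgr_eq0 h -cE.
    rewrite -cE; apply/eqP; rewrite sgr_eq0 eq_le.
    by rewrite (ge t Tt) ?(le t Tt)// => y; rewrite z.
  + rewrite -cE gtr0_sg//; apply: (gt t Tt) => y; by rewrite -sgr_gt0 h -cE ltr01.
  + rewrite -cE ltr0_sg//; apply: (lt t Tt) => y; by rewrite -sgr_lt0 h -cE ltrN10.
- move=> t Tt; have [_ _ p] := pr t Tt; have [_ _ np] := npr t Tt.
  (* The two halves of compact support are carried separately, by m and by its opposite. *)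
  rewrite -m00 !compactly_supportedP !nm_at.
  by split=> -[a b]; split; [exact/p|exact/np|exact/p|exact/np].
- by move=> h t x Tt; have [H _] := hz t Tt; have [] := H (ge t Tt h) x.
- by move=> h t x Tt; have [_ H] := hz t Tt; have [] := H (le t Tt h) x.
- by move=> h t x Tt; have [H _] := hz t Tt; have [] := H (ge t Tt h) x.
- by move=> h t x Tt; have [_ H] := hz t Tt; have [] := H (le t Tt h) x.
Qed.
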